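(* Let $\alpha\in(0,1)$, let $X_0(t)$ be a Lévy process in $\mathbb{R}^d$ starting at zero, and let $X(t)=x+X_0(t)$ for $x\in\mathbb{R}^d$. Let $L_x$, with domain $D(L_x)$, be the generator of the semigroup $P(t)f(x)=E_x[f(X_t)]$ on $L^1(\mathbb{R}^d)$. Then, for any $f\in D(L_x)$, the unique solution of the Cauchy problem $$T_\alpha u(t,x)=L_xu(t,x),\quad t>0;\qquad u(0,x)=f(x),$$ is given by $$u(t,x)=P(t^\alpha/\alpha)f(x)=E_x[f(X_{t^\alpha/\alpha})].$$
   Context: Conformable derivative: for $\alpha\in(0,1)$, a function $g$ on $[0,\infty)$ and $t>0$, $T_\alpha(g)(t)=\lim_{\varepsilon\to 0}\frac{g(t+\varepsilon t^{1-\alpha})-g(t)}{\varepsilon}$; here $T_\alpha$ acts in the variable $t$, with limit in $L^1(\mathbb{R}^d)$ norm for $L^1$-valued functions. Lévy process: $X_t=X(t)$, and $E_x[f(X_t)]=E[f(x+X_0(t))]$. The characteristic function is $E[\exp(ik\cdot X_0(t))]=\exp(t\psi(k))$ with $$\psi(k)=ik\cdot a-\tfrac12 k\cdot Qk+\int_{y\ne0}\Big(e^{ik\cdot y}-1-\frac{ik\cdot y}{1+\|y\|^2}\Big)\phi(dy),$$ where $a\in\mathbb{R}^d$, $Q$ is a nonnegative definite $d\times d$ matrix and $\phi$ is a $\sigma$-finite Borel measure with $\int_{y\neq0}\min\{1,\|y\|^2\}\,\phi(dy)<\infty$. Generator: with $\hat g(k)=\int_{\mathbb{R}^d}e^{-ik\cdot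 x}g(x)\,dx$, the domain is $$D(L_x)=\{g\in L^1(\mathbb{R}^d):\ \text{there is } h\in L^1(\mathbb{R}^d)\text{ with }\psi(k)\hat g(k)=\hat h(k)\text{ for all }k\},$$ and $L_xg=h$, i.e. $L_xg$ is the inverse Fourier transform of $\psi\hat g$. For $g\in W^{2,1}(\mathbb{R}^d)$ ($L^1$ functions whose first and second partial derivatives are all in $L^1$), $$L_xg(x)=a\cdot\nabla g(x)+\tfrac12\nabla\cdot Q\nabla g(x)+\int_{y\neq0}\Big(g(x+y)-g(x)-\frac{\nabla g(x)\cdot y}{1+\|y\|^2}\Big)\phi(dy).$$ A solution is a continuous map $t\mapsto u(t,\cdot)$ from $[0,\infty)$ to $L^1(\mathbb{R}^d)$ with $u(0,\cdot)=f$ such that, for every $t>0$, $u(t,\cdot)\in D(L_x)$, the limit defining $T_\alpha u(t,\cdot)$ exists, and it equals $L_xu(t,\cdot)$. *)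

(* Defs.v *)
From HB Require Import structures.
From mathcomp Require Import all_boot all_order all_algebra.
From mathcomp Require Import all_classical all_reals all_analysis.
From mathcomp Require Import measurable_realfun complex.

Set Implicit Arguments.
Unset Strict Implicit.
Unset Printing Implicit Defensive.
Import Order.TTheory GRing.Theory Num.Theory.
Import numFieldNormedType.Exports.

Local Open Scope classical_set_scope.
Local Open Scope ring_scope.
Local Open Scope complex_scope.

(* 'rV[R]_d carries its Borel sigma-algebra. *)
Section borel_rV.
Context (R : realType) (d : nat).

Definition borel_rV_display : measure_display :=
  sigma_display (@open 'rV[R]_d).

HB.instance Definition _ := @isMeasurable.Build borel_rV_display 'rV[R]_d
  <<s (@open 'rV[R]_d) >>
  (@sigma_algebra0 _ _ _) (@sigma_algebraC _ _) (@sigma_algebra_bigcup _ _ _).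

Lemma measurable_coord_rV (i : 'I_d) :
  measurable_fun setT (fun x : 'rV[R]_d => x 0 i).
Proof.
apply: (measurability _ (RGenOpens.measurableE R)).
move=> _ [_ [a [b ->] <-]]; rewrite setTI; apply: sub_sigma_algebra.
apply: open_comp; last exact: interval_open.
by move=> x _; exact: coord_continuous.
Qed.

Lemma open_rV_cubes (O : set 'rV[R]_d) : open O ->
  let cube (c : 'rV[rat]_d * nat) :=
    [set x : 'rV[R]_d | forall i, `|ratr (c.1 0 i) - x 0 i| < c.2.+1%:R^-1] in
  O = \bigcup_(c in [set c | cube c `<=` O]) cube c.
Proof.
move=> oO cube; apply/seteqP; split=> [x Ox|x [c cO cx]]; last exact: cO.
have /nbhs_ballP[e /= e0 eO] := oO x Ox.
have [n n0 ne] : exists2 n : nat, true & n.+1%:R^-1 < e / 2.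
  have e20 : 0 < e / 2 by rewrite divr_gt0.
  have [n _ /(_ n (leqnn _)) ne] := near_infty_natSinv_lt (PosNum e20).
  by exists n.
have [q qx] : exists q : 'rV[rat]_d,
    forall i, `|ratr (q 0 i) - x 0 i| < n.+1%:R^-1.
  have H i : exists r : rat, `|ratr r - x 0 i| < n.+1%:R^-1.
    have lt : x 0 i < x 0 i + n.+1%:R^-1 by rewrite ltrDl invr_gt0.
    have [r] := rat_in_itvoo lt; rewrite in_itv/= => /andP[r1 r2].
    by exists r; rewrite ger0_norm ?subr_ge0 ?ltW// ltrBlDl.
  have [r rx] := choice H.
  by exists (\row_i r i) => i; rewrite mxE.
exists (q, n) => //= y qy; apply: eO; split => //= i j.
rewrite (ord1 i) /ball/=.
apply: le_lt_trans (ler_distD (ratr (q 0 j)) _ _) _.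
rewrite (splitr e) ltrD//; last exact: lt_trans (qy j) ne.
by rewrite distrC; exact: lt_trans (qx j) ne.
Qed.

Lemma measurable_fun_rVP d1 (T : measurableType d1) (f : T -> 'rV[R]_d) :
  measurable_fun setT f <->
  forall i, measurable_fun setT (fun t => f t 0 i).
Proof.
split=> [mf i|mf]; first exact: measurableT_comp (measurable_coord_rV i) mf.
apply: (@measurability _ _ _ _ _ _ (@open 'rV[R]_d)) => //.
move=> _ [U oU <-]; rewrite setTI (open_rV_cubes oU) preimage_bigcup.
rewrite bigcup_mkcond; apply: countable_bigcupT_measurable; first exact: countableP.
move=> c; case: ifP => // _; rewrite /preimage/=.
rewrite (_ : mkset _ = \bigcap_(i in [set: 'I_d])
    (fun t => ratr (c.1 0 i) - f t 0 i) @^-1` ball 0 (c.2.+1%:R^-1)); last first.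
  apply/seteqP; split=> [t /= H i _|t /= H i]; last first.
    by have := H i I; rewrite /ball/= sub0r normrN.
  by rewrite /ball/= sub0r normrN.
apply: fin_bigcap_measurable => // i _.
rewrite -[X in measurable X]setTI.
apply: measurable_funB => //.
by apply: measurable_ball.
Qed.

End borel_rV.

Section lebesgue_rV.
Context (R : realType).

Definition cons_rV (d : nat) (p : R * 'rV[R]_d) : 'rV[R]_d.+1 :=
  row_mx (p.1%:M : 'rV[R]_1) p.2.

Lemma measurable_cons_rV (d : nat) : measurable_fun setT (@cons_rV d).
Proof.
apply/measurable_fun_rVP => i.
have [j|j] := @splitP 1 d i => ij.
  rewrite [X in measurable_fun _ X](_ : _ = fst); last first.
    apply/funext => p; rewrite /cons_rV (_ : i = lshift d j); last exact: val_inj.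
    by rewrite (@row_mxEl _ 1 1 d) mxE (ord1 j) eqxx mulr1n.
  exact: measurable_fst.
rewrite [X in measurable_fun _ X](_ : _ = (fun x : 'rV[R]_d => x 0 j) \o snd); last first.
  apply/funext => p; rewrite /cons_rV (_ : i = rshift 1 j); last exact: val_inj.
  by rewrite (@row_mxEr _ 1 1 d).
exact: measurableT_comp (measurable_coord_rV j) measurable_snd.
Qed.

Lemma cons_rV_split (d : nat) (v : 'rV[R]_d.+1) :
  v = cons_rV (v 0 0, \row_(i < d) v 0 (lift 0 i)).
Proof.
apply/rowP => i; rewrite /cons_rV.
have [j|j] := @splitP 1 d i => ij.
  rewrite (_ : i = lshift d j); last exact: val_inj.
  rewrite (@row_mxEl _ 1 1 d) mxE (ord1 j) eqxx mulr1n/=; congr (v 0 _).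
  exact: val_inj.
rewrite (_ : i = rshift 1 j); last exact: val_inj.
rewrite (@row_mxEr _ 1 1 d) mxE; congr (v 0 _).
exact: val_inj.
Qed.

Lemma cons_rV_inj (d : nat) : injective (@cons_rV d).
Proof.
move=> [x y] [x' y'] /(@eq_row_mx _ 1 1 d)[/= /rowP/(_ 0)].
by rewrite !mxE !eqxx !mulr1n => -> ->.
Qed.

HB.instance Definition _ (d : nat) :=
  @isMeasurableFun.Build _ _ _ _ (@cons_rV d) (@measurable_cons_rV d).

Section step.
Context (d : nat) (m : {sigma_finite_measure set 'rV[R]_d -> \bar R}).

Definition lebesgue_cons : set 'rV[R]_d.+1 -> \bar R :=
  pushforward (@lebesgue_measure R \x m)%E (@cons_rV d).

Let lebesgue_cons0 : lebesgue_cons set0 = 0%E.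
Proof. by rewrite /lebesgue_cons /pushforward preimage_set0 measure0. Qed.

Let lebesgue_cons_ge0 A : (0 <= lebesgue_cons A)%E.
Proof. by rewrite /lebesgue_cons /pushforward; exact: measure_ge0. Qed.

Let lebesgue_cons_sigma_additive : semi_sigma_additive lebesgue_cons.
Proof.
have mc := @measurable_cons_rV d.
move=> F mF tF mUF; rewrite /lebesgue_cons /pushforward preimage_bigcup.
apply: measure_semi_sigma_additive.
- by move=> n; rewrite -[X in measurable X]setTI; exact: mc.
- apply/trivIsetP => /= i j _ _ ij; rewrite -preimage_setI.
  by move/trivIsetP : tF => /(_ _ _ _ _ ij) ->//; rewrite preimage_set0.
- by rewrite -preimage_bigcup -[X in measurable X]setTI; exact: mc.
Qed.

HB.instance Definition _ := isMeasure.Build _ _ _ lebesgue_cons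
  lebesgue_cons0 lebesgue_cons_ge0 lebesgue_cons_sigma_additive.

Lemma sigma_finite_lebesgue_cons : sigma_finite setT lebesgue_cons.
Proof.
have /sigma_finiteP[A [TA ndA Aoo]] := sigma_finiteT (@lebesgue_measure R).
have /sigma_finiteP[B [TB ndB Boo]] := sigma_finiteT m.
pose tl (v : 'rV[R]_d.+1) : 'rV[R]_d := \row_i v 0 (lift 0 i).
exists (fun n => [set v : 'rV[R]_d.+1 | A n (v 0 0) /\ B n (tl v)]).
  apply/seteqP; split=> // v _.
  have [k _ Ak] : (\bigcup_i A i) (v 0 0) by rewrite -TA.
  have [l _ Bl] : (\bigcup_i B i) (tl v) by rewrite -TB.
  exists (maxn k l) => //; split.
  - by move: (v 0 0) Ak; exact/subsetPset/ndA/leq_maxl.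
  - by move: (tl v) Bl; exact/subsetPset/ndB/leq_maxr.
move=> k; have [mA Afin] := Aoo k; have [mB Bfin] := Boo k; split.
  apply: measurableI.
    rewrite -[X in measurable X]setTI.
    exact: (measurable_coord_rV (0 : 'I_d.+1)).
  rewrite -[X in measurable X]setTI.
  suff /(_ measurableT _ mB) :
    measurable_fun setT tl by [].
  apply/measurable_fun_rVP => i.
  rewrite [X in measurable_fun _ X](_ : _ = fun v : 'rV[R]_d.+1 => v 0 (lift 0 i)).
    exact: measurable_coord_rV.
  by apply/funext => v; rewrite /tl mxE.
rewrite /lebesgue_cons /pushforward (_ : _ @^-1` _ = A k `*` B k).
  by rewrite product_measure1E// lte_mul_pinfty// ge0_fin_numE.
have consK p : ((cons_rV p) 0 0, tl (cons_rV p)) = p.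
  exact/esym/cons_rV_inj/cons_rV_split.
by apply/seteqP; split=> -[x y] /=; have [-> ->] := consK (x, y).
Qed.

HB.instance Definition _ :=
  Measure_isSigmaFinite.Build _ _ _ lebesgue_cons sigma_finite_lebesgue_cons.

End step.

(* Lebesgue measure on R^d as the d-fold product of the one-dimensional
   Lebesgue measure; on R^0 it is the unit mass. *)
Fixpoint lebesgue_rV (d : nat) : {sigma_finite_measure set 'rV[R]_d -> \bar R} :=
  match d with
  | 0 => [the {sigma_finite_measure set 'rV[R]_0 -> \bar R} of \d_(0 : 'rV[R]_0)]
  | n.+1 => [the {sigma_finite_measure set 'rV[R]_n.+1 -> \bar R} of
             lebesgue_cons (lebesgue_rV n)]
  end.

End lebesgue_rV.

Section complex_integration.
Context (R : realType).

Definition cexp (z : R[i]) : R[i] :=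
  (expR (complex.Re z))%:C * (cos (complex.Im z) +i* sin (complex.Im z)).

Definition cintegral (disp : measure_display) (T : measurableType disp)
    (mu : {measure set T -> \bar R}) (D : set T) (f : T -> R[i]) : R[i] :=
  (\int[mu]_(x in D) complex.Re (f x)) +i* (\int[mu]_(x in D) complex.Im (f x)).

End complex_integration.

Section levy.
Context (R : realType) (d : nat).
Implicit Types x y k : 'rV[R]_d.

Definition dot x y : R := (x *m y^T) 0 0.

(* Euclidean norm; the library's norm `|x| on 'rV[R]_d is the sup norm. *)
Definition enorm x : R := Num.sqrt (dot x x).

Definition fourier (g : 'rV[R]_d -> R) k : R[i] :=
  cintegral (lebesgue_rV R d) setT
    (fun x => cexp (- ((dot k x)*i)) * (g x)%:C).

(* Row vectors are used throughout, so that the column vector Q k is the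
   row vector k *m Q^T. *)
Definition levy_exponent (a : 'rV[R]_d) (Q : 'M[R]_d)
    (phi : {measure set 'rV[R]_d -> \bar R}) k : R[i] :=
  (dot k a)*i - (2^-1 * dot k (k *m Q^T))%:C +
  cintegral phi [set y : 'rV[R]_d | y != 0] (fun y =>
    cexp ((dot k y)*i) - 1 - (dot k y / (1 + enorm y ^+ 2))*i).

Definition levy_triplet (Q : 'M[R]_d)
    (phi : {measure set 'rV[R]_d -> \bar R}) : Prop :=
  [/\ forall k, 0 <= dot k (k *m Q^T),
      sigma_finite [set y : 'rV[R]_d | y != 0] phi &
      (\int[phi]_(y in [set y : 'rV[R]_d | y != 0%R])
         (Num.min 1 (enorm y ^+ 2))%:E < +oo)%E].

Definition increment (Omega : Type) (X : R -> Omega -> 'rV[R]_d) (s t : R)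
    (w : Omega) : 'rV[R]_d := X t w - X s w.

(* The time set is [0, +oo[; the values X t for t < 0 are irrelevant.
   Stochastic continuity is the only regularity assumed: cadlag paths, which
   some authors add to the definition, imply it. *)
Record levy_process (disp : measure_display) (Omega : measurableType disp)
    (P : probability Omega R) (X : R -> Omega -> 'rV[R]_d) : Prop := {
  levy_measurable : forall t : R, 0 <= t -> measurable_fun setT (X t);
  levy_start0 : {ae P, forall w, X 0 w = 0};
  levy_independent_increments : forall (n : nat) (t : nat -> R)
      (B : nat -> set 'rV[R]_d),
    0 <= t 0%N -> (forall i, t i <= t i.+1) -> (forall i, measurable (B i)) ->
    (P (\big[setI/setT]_(i < n) (increment X (t i) (t i.+1) @^-1` B i)) =
     \prod_(i < n) P (increment X (t i) (t i.+1) @^-1` B i))%E;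
  levy_stationary_increments : forall (s t : R) (B : set 'rV[R]_d),
    0 <= s -> 0 <= t -> measurable B ->
    P (increment X s (s + t) @^-1` B) = P (increment X 0 t @^-1` B);
  levy_stochastically_continuous : forall t e : R, 0 <= t -> 0 < e ->
    P [set w | e < enorm (X s w - X t w)]
      @[s --> within [set s : R | 0 <= s] (nbhs t)] --> 0%E
}.

Definition levy_semigroup (disp : measure_display) (Omega : measurableType disp)
    (P : probability Omega R) (X : R -> Omega -> 'rV[R]_d) (t : R)
    (f : 'rV[R]_d -> R) x : R :=
  fine 'E_P[fun w => f (x + X t w)%R]%E.

Local Notation L1 := (Lfun (lebesgue_rV R d) 1%E).

(* Elements of L^1(R^d) are given by real-valued Borel representatives; limits in L^1 are
   expressed with the seminorm, so they are insensitive to this choice. *)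
Definition cvg_L1 (F : set_system R) (g : R -> 'rV[R]_d -> R)
    (l : 'rV[R]_d -> R) : Prop :=
  Lnorm (lebesgue_rV R d) 1%E (fun x => (g s x - l x)%:E) @[s --> F] --> 0%E.

Definition conformable_derivative_L1 (alpha : R) (u : R -> 'rV[R]_d -> R)
    (t : R) (h : 'rV[R]_d -> R) : Prop :=
  cvg_L1 0^' (fun e x => (u (t + e * t `^ (1 - alpha)) x - u t x) / e) h.

(* levy_generator psi g h means: g belongs to D(L_x) and L_x g = h. *)
Definition levy_generator (psi : 'rV[R]_d -> R[i]) (g h : 'rV[R]_d -> R) : Prop :=
  [/\ g \in L1, h \in L1 & forall k, psi k * fourier g k = fourier h k].

Definition levy_domain (psi : 'rV[R]_d -> R[i]) (g : 'rV[R]_d -> R) : Prop :=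
  exists h, levy_generator psi g h.

Record cauchy_solution (alpha : R) (psi : 'rV[R]_d -> R[i])
    (f : 'rV[R]_d -> R) (u : R -> 'rV[R]_d -> R) : Prop := {
  cauchy_L1 : forall t : R, 0 <= t -> u t \in L1;
  cauchy_continuous : forall t : R, 0 <= t ->
    cvg_L1 (within [set s : R | 0 <= s] (nbhs t)) u (u t);
  cauchy_initial : u 0 = f %[ae lebesgue_rV R d];
  cauchy_equation : forall t : R, 0 < t ->
    exists2 h, levy_generator psi (u t) h & conformable_derivative_L1 alpha u t h
}.

End levy.

(* Main.v *)
Require Import Defs.
From HB Require Import structures.
From mathcomp Require Import all_boot all_order all_algebra.
From mathcomp Require Import all_classical all_reals all_analysis.
From mathcomp Require Import measurable_realfun complex.
From mathcomp Require Import ring lra gauss_integral.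
Import Order.TTheory GRing.Theory Num.Theory.
Import numFieldNormedType.Exports.
Set Implicit Arguments.
Unset Strict Implicit.
Unset Printing Implicit Defensive.
Local Open Scope classical_set_scope.
Local Open Scope ring_scope.
Local Open Scope complex_scope.

(** The whole argument takes place on the Fourier side, where the process acts
by multiplication: the transform of P(t)f is exp(t psi) times that of f, because
the average of the translates f(. + X_t) has the characteristic function of X_t
as its Fourier multiplier ([fourier_levy]).  The substitution s = t^alpha/alpha
turns the conformable derivative into the ordinary one
([conformable_time_speed], [is_derive_of_conformable]), so the equation reads
d/ds u = L u with s as time.

Uniqueness.  If v is a solution, then at each fixed frequency k its transform is
a continuous curve in the complex plane solving the linear equation
z' = psi(k) z in the time s; it is therefore exp(s psi(k)) times its initial
value ([orbit_unique], [cauchy_solution_fourier]).  This is the transform of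
P(s)f, and an integrable function is determined almost everywhere by its
transform ([fourier_inj_ae]).

Existence.  Continuity of t |-> P(t)f in L1 follows from continuity of
translations in L1 and stochastic continuity of the process
([levy_semigroup_continuous]).  For f in the domain, with h = L f, the limit of
the difference quotients is P(t)h as soon as
  || P(r')f - P(r)f - (r' - r) P(r)h || <= |r' - r| sup_q || P(q)h - P(r)h ||
with q ranging between r and r' ([levy_increment_le]).  One would like to write
P(r')f - P(r)f as the integral of P(q)h over q; since the process is only
stochastically continuous, (q, w) |-> X_q(w) need not be jointly measurable, so
Riemann sums are used instead.  The Riemann sums of P(q)h - P(r)h obey the bound
above, and their Fourier transforms converge, at each frequency, to that of the
left-hand side: at one frequency this is the convergence of the Riemann sums of
the derivative of exp(q psi(k)) ([orbit_re_riemann]).  The bound passes to the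
limit by [l1norm_le_of_fourier_cvg]: the L1 norm is lower semicontinuous for
pointwise convergence of Fourier transforms on norm-bounded sequences.

That semicontinuity also yields uniqueness of Fourier transforms, so it is the
analytic heart of the file.  It is proved by mollification.  The product p of
the kernels 2/(1 + y^2) is the transform of the integrable product of the
exp(-|k|) ([fourier_expNrV]), so the mollification of g by p at any scale is an
explicit integral of the transform of g ([mollify_inversion]).  Hence the
mollifications converge pointwise when the transforms do, Fatou's lemma bounds
their norms, and at small scale they are close in L1 to a constant multiple of
g, again by continuity of translations. *)

(** * Affine changes of variables and iterated integrals on R^d *)

Section affine1.
Context {R : realType}.
Local Notation leb := (@lebesgue_measure R).
Local Notation RT := (measurableTypeR R).

Lemma measurable_affine1 (c e : R) :
  measurable_fun setT (fun x : RT => (c + e * x)%R : RT).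
Proof.
apply: measurable_funD; first exact: measurable_cst.
by apply: measurable_funM => //; exact: measurable_cst.
Qed.

Lemma lebesgue_measure_affine (c e : R) (e0 : 0 < e) (A : set RT) :
  measurable A ->
  (leb A = e%:E * pushforward leb (fun x : RT => (c + e * x)%R : RT) A)%E.
Proof.
have e0' : 0 <= e by exact: ltW.
pose nu := mscale (NngNum e0')
  (measure_function_pushforward__canonical__measure_function_Measure leb
    (measurable_affine1 c e)).
move=> mA.
rewrite -[RHS]/(nu A).
move: A mA; apply: lebesgue_measure_unique => _ [[a b]] _ <-.
transitivity (e%:E * leb `]((a - c) / e)%R, ((b - c) / e)%R]%classic)%E; last first.
  apply/esym; congr (_ * leb _)%E; apply/seteqP; split => x /=;
  by rewrite !in_itv/= ltr_pdivrMr// ler_pdivlMr// ltrBlDl lerBrDl (mulrC x).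
rewrite !lebesgue_measure_itv/= !lte_fin.
rewrite ltr_pM2r ?invr_gt0// ltrD2r; case: ifPn => _; last by rewrite mule0.
rewrite -EFinM; congr EFin; field; exact: lt0r_neq0.
Qed.

(** Both sides integrate F against the same measure, since the image of the
Lebesgue measure by an affine map is a multiple of it. *)
Lemma ge0_integral_affine1 (c e : R) (F : R -> \bar R) : 0 < e ->
  measurable_fun setT (F : RT -> \bar R) -> (forall x, 0 <= F x)%E ->
  (\int[leb]_x F x = e%:E * \int[leb]_x F (c + e * x)%R)%E.
Proof.
move=> e0 mF F0.
have e0' : 0 <= e by exact: ltW.
rewrite -[X in (_ * X)%E](ge0_integral_pushforward (measurable_affine1 c e) leb measurableT)//.
rewrite -(@ge0_integral_mscale _ _ _
  (measure_function_pushforward__canonical__measure_function_Measure leb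
    (measurable_affine1 c e)) _ measurableT (NngNum e0'))//.
by apply: eq_measure_integral => A mA _; exact: lebesgue_measure_affine.
Qed.

End affine1.

Section lebesgue_rV_integral.
Context {R : realType}.
Local Notation leb := (@lebesgue_measure R).
Local Open Scope ereal_scope.

Lemma lebesgue_rVS d : (lebesgue_rV R d.+1 : set _ -> \bar R) = pushforward (leb \x lebesgue_rV R d) (@cons_rV R d).
Proof. by []. Qed.
(** [measurable_cons_rV] with the line typed as the domain of the Lebesgue
measure, which is what matching against product measures requires. *)
Lemma measurable_consT d : measurable_fun setT (@cons_rV R d : (measurableTypeR R * 'rV[R]_d)%type -> 'rV[R]_d.+1).
Proof. exact: measurable_cons_rV. Qed.

Lemma ge0_integral_cons d (F : 'rV[R]_d.+1 -> \bar R) :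
  measurable_fun setT F -> (forall x, 0 <= F x) ->
  \int[lebesgue_rV R d.+1]_x F x =
  \int[leb]_s \int[lebesgue_rV R d]_x F (cons_rV (s, x)).
Proof.
move=> mF F0.
rewrite lebesgue_rVS (ge0_integral_pushforward (@measurable_consT d) _ measurableT)//=.
by rewrite preimage_setT fubini_tonelli1//=; apply: measurableT_comp => //; exact: measurable_cons_rV.
Qed.
Lemma integrable_cons d (F : 'rV[R]_d.+1 -> \bar R) :
  (lebesgue_rV R d.+1).-integrable setT F ->
  (leb \x lebesgue_rV R d).-integrable setT (F \o @cons_rV R d).
Proof.
move=> /integrableP[mF iF]; apply/integrableP; split.
  by apply: measurableT_comp => //; exact: measurable_cons_rV.
apply: le_lt_trans iF.
rewrite lebesgue_rVS (ge0_integral_pushforward (@measurable_consT d) _ measurableT)//=.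
exact: measurableT_comp.
Qed.

Lemma integral_cons d (F : 'rV[R]_d.+1 -> \bar R) :
  (lebesgue_rV R d.+1).-integrable setT F ->
  \int[lebesgue_rV R d.+1]_x F x =
  \int[leb]_s \int[lebesgue_rV R d]_x F (cons_rV (s, x)).
Proof.
move=> iF; have iF2 := integrable_cons iF.
have mF : measurable_fun setT F by case/integrableP : iF.
by rewrite lebesgue_rVS (integral_pushforward (@measurable_consT d) mF iF2 measurableT)
  preimage_setT -integral12_prod_meas1.
Qed.

End lebesgue_rV_integral.

Section measurable_rV.
Context {R : realType} {d : nat} {disp : measure_display} {T : measurableType disp}.
Implicit Types f g : T -> 'rV[R]_d.

Lemma measurable_addrV f g : measurable_fun setT f -> measurable_fun setT g ->
  measurable_fun setT (fun t => f t + g t).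
Proof.
move=> /measurable_fun_rVP mf /measurable_fun_rVP mg; apply/measurable_fun_rVP => i.
under eq_fun do rewrite mxE.
exact: measurable_funD.
Qed.

Lemma measurable_scalerV (e : T -> R) f : measurable_fun setT e -> measurable_fun setT f ->
  measurable_fun setT (fun t => e t *: f t).
Proof.
move=> me /measurable_fun_rVP mf; apply/measurable_fun_rVP => i.
under eq_fun do rewrite mxE.
exact: measurable_funM.
Qed.

Lemma measurable_dotrV f g : measurable_fun setT f -> measurable_fun setT g ->
  measurable_fun setT (fun t => dot (f t) (g t)).
Proof.
move=> /measurable_fun_rVP mf /measurable_fun_rVP mg.
rewrite (_ : (fun t => _) = (fun t => \sum_(i < d) f t 0 i * g t 0 i)); last first.
  by apply/funext => t; rewrite /dot mxE; apply: eq_bigr => i _; rewrite mxE.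
by apply: measurable_sum => i; exact: measurable_funM.
Qed.

End measurable_rV.

Section affine_rV.
Context {R : realType}.
Local Notation leb := (@lebesgue_measure R).

Lemma cons_rVE_affine d (c : 'rV[R]_d.+1) (e s : R) (x : 'rV[R]_d) :
  c + e *: cons_rV (s, x) =
  cons_rV (c 0 0 + e * s, (\row_i c 0 (lift 0 i)) + e *: x).
Proof.
rewrite [LHS](cons_rV_split (c + e *: cons_rV (s, x))).
have cE i : cons_rV (s, x) 0 i = if unlift 0 i is Some j then x 0 j else s.
  have [j ij|i0] := unliftP 0 i.
    by rewrite /cons_rV (_ : i = rshift 1 j) ?(@row_mxEr _ 1 1 d)//; apply/val_inj; rewrite ij.
  rewrite /cons_rV (_ : i = lshift d (0 : 'I_1)) ?(@row_mxEl _ 1 1 d) ?mxE ?eqxx ?mulr1n//.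
  by apply/val_inj; rewrite i0.
congr cons_rV; congr pair.
  by rewrite mxE; congr (_ + _); rewrite mxE cE unlift_none.
apply/rowP => i; rewrite mxE [LHS]mxE [RHS]mxE; congr (_ + _); first by rewrite mxE.
by rewrite [LHS]mxE [RHS]mxE cE liftK.
Qed.

Lemma measurable_affine_rV d (c : 'rV[R]_d) (e : R) :
  measurable_fun setT (fun x : 'rV[R]_d => c + e *: x).
Proof.
apply: measurable_addrV; first exact: measurable_cst.
by apply: measurable_scalerV; [exact: measurable_cst|exact: measurable_id].
Qed.

(** One coordinate is changed at a time, by induction on the dimension: each
contributes a factor e. *)
Lemma ge0_integral_affine d (c : 'rV[R]_d) (e : R) (F : 'rV[R]_d -> \bar R) :
  0 < e -> measurable_fun setT F -> (forall x, 0 <= F x)%E ->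
  (\int[lebesgue_rV R d]_x F x =
   (e ^+ d)%:E * \int[lebesgue_rV R d]_x F (c + e *: x)%R)%E.
Proof.
move=> e0; elim: d c F => [|d IH] c F mF F0.
  rewrite expr0 mul1e; apply: eq_integral => x _; congr F.
  by apply/rowP => -[].
have mc (s : R) : measurable_fun setT (fun x : 'rV[R]_d => cons_rV (s, x)).
  by apply: measurableT_comp; [exact: measurable_cons_rV|exact: measurable_pair1].
pose c' : 'rV[R]_d := \row_i c 0 (lift 0 i).
have me : 0 <= e ^+ d by rewrite exprn_ge0// ltW.
rewrite ge0_integral_cons//.
under eq_integral => s _.
  rewrite (IH c'); [|exact: measurableT_comp|by []].
  over.
have mF2 : measurable_fun setT (fun p : measurableTypeR R * 'rV[R]_d => F (cons_rV (p.1, c' + e *: p.2))).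
  apply: measurableT_comp => //.
  apply: (measurableT_comp (@measurable_consT R d)).
  apply/measurable_fun_pairP; split; first exact: measurable_fst.
  exact: measurableT_comp (measurable_affine_rV c' e) measurable_snd.
have mG := measurable_fun_fubini_tonelli_F (m2 := lebesgue_rV R d) _ mF2 (fun p => F0 _).
rewrite ge0_integralZl//; last by move=> s _; exact: integral_ge0.
rewrite (ge0_integral_affine1 (c 0 0) e0 mG); last by move=> s; exact: integral_ge0.
rewrite muleA -EFinM exprSr; congr (_ * _)%E.
rewrite ge0_integral_cons//; last by apply: measurableT_comp => //; exact: measurable_affine_rV.
apply: eq_integral => s _; apply: eq_integral => x _.
by rewrite cons_rVE_affine.
Qed.

Lemma ge0_integral_shift d (c : 'rV[R]_d) (F : 'rV[R]_d -> \bar R) :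
  measurable_fun setT F -> (forall x, 0 <= F x)%E ->
  (\int[lebesgue_rV R d]_x F (x + c)%R = \int[lebesgue_rV R d]_x F x)%E.
Proof.
move=> mF F0; rewrite [RHS](ge0_integral_affine c ltr01 mF F0) expr1n mul1e.
by apply: eq_integral => x _; rewrite scale1r addrC.
Qed.

End affine_rV.

(** * Continuity of translations in L1 *)
Section cvge0.
Context {R : realType}.
Local Open Scope ereal_scope.

Lemma ge0_cvge0P {T : Type} (F : set_system T) {FF : Filter F} (f : T -> \bar R) :
  (forall x, 0 <= f x) ->
  f x @[x --> F] --> 0 <-> (forall e : R, (0 < e)%R -> \forall x \near F, f x <= e%:E).
Proof.
move=> f0; split => [cf e e0|H].
  apply: (cf [set y | y <= e%:E]).
  rewrite /nbhs/= /ereal_nbhs/=; apply/nbhs_ballP; exists e => //= r.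
  by rewrite /ball/= sub0r normrN lee_fin => re; rewrite (le_trans (ler_norm _))// ltW.
move=> A; rewrite /nbhs/= /ereal_nbhs/= => /nbhs_ballP[e /= e0 eA].
have e20 : (0 < e / 2)%R by rewrite divr_gt0.
apply: filterS (H _ e20) => x /=.
move: (f0 x); case: (f x) => [r| |]//=; rewrite !lee_fin => r0 re.
apply: eA; rewrite /ball/= sub0r normrN ger0_norm//.
by rewrite (le_lt_trans re)// ltr_pdivrMr// ltr_pMr// ltr1n.
Qed.

Lemma cvge0_exists (f : nat -> \bar R) : (forall n, 0 <= f n) ->
  f n @[n --> \oo] --> 0 -> forall e : R, (0 < e)%R -> exists n, f n <= e%:E.
Proof.
by move=> f0 /(ge0_cvge0P f0) cf e /cf[n _ /(_ _ (leqnn _)) ?]; exists n.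
Qed.

Lemma ge0_cvge0_le {T : Type} (F : set_system T) {FF : Filter F} (f g h : T -> \bar R) :
  (forall x, 0 <= f x) -> (forall x, f x <= g x + h x) ->
  g x @[x --> F] --> 0 -> h x @[x --> F] --> 0 -> f x @[x --> F] --> 0.
Proof.
move=> f0 fgh cg ch; apply: (@squeeze_cvge _ _ _ _ (cst 0) _ (g \+ h)).
- by apply: nearW => x; rewrite f0 fgh.
- exact: cvg_cst.
- by rewrite -[X in _ --> X]adde0; apply: cvgeD.
Qed.

End cvge0.

Lemma integral_norm_ge0 {R : realType} {disp : measure_display}
    {T : measurableType disp} (m : {measure set T -> \bar R}) (D : set T) (f : T -> R) :
  (0 <= \int[m]_(x in D) `|f x|%:E)%E.
Proof. by apply: integral_ge0 => x _; rewrite lee_fin. Qed.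

Section translation1.
Context {R : realType}.
Local Notation leb := (@lebesgue_measure R).
Local Notation RT := (measurableTypeR R).

(** The integrands tend to 0 pointwise by continuity, and since the shifts are
bounded they all vanish outside one compact interval, so convergence is
dominated. *)
Lemma translation_cvg_compact (h : R -> R) (M N : R) (y : nat -> R) :
  continuous h -> (forall x, `|h x| <= M) -> (forall x, N < `|x| -> h x = 0) ->
  y n @[n --> \oo] --> 0 ->
  (\int[leb]_x `|h (x + y n) - h x|%:E)%E @[n --> \oo] --> 0%E.
Proof.
move=> ch hM hN y0.
have [B [_ yB]] : bounded_fun y by apply: cvg_seq_bounded; apply/cvg_ex; exists 0.
have {}yB n : `|y n| <= `|B| + 1.
  by apply: (yB (`|B| + 1)) => //; rewrite ltr_pwDr// ler_norm.
(* beyond K both x and x + y n leave the support of h *)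
pose K : R := `|N| + `|B| + 1.
have mh : measurable_fun setT (h : RT -> R) by apply: continuous_measurable_fun.
pose g : R -> \bar R := fun x => (2 * M * \1_(`[- K, K]) x)%:E.
have := @dominated_convergence _ _ _ leb setT measurableT
  (fun n x => `|h (x + y n) - h x|%:E) (cst 0%E) g.
case.
- move=> n; apply/measurable_EFinP; apply: measurableT_comp => //; apply: measurable_funB => //.
  apply: measurableT_comp => //; apply: measurable_funD => //.
- exact: measurable_cst.
- apply: aeW => x _.
  apply: cvg_EFin; first exact: nearW.
  rewrite -[X in _ --> X](@normr0 _ R) -(subrr (h x)).
  apply: cvg_norm; apply: cvgB; last exact: cvg_cst.
  apply: continuous_cvg; first exact: ch.
  by rewrite -[X in _ --> X](addr0 x); apply: cvgD => //; exact: cvg_cst.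
- rewrite /g; under eq_fun do rewrite EFinM.
  apply: integrableZl => //.
  apply: integrable_indic_itv.
- apply: aeW => x n _ /=.
  rewrite /g lee_fin normr_id indicE.
  have M0 : 0 <= M by exact: le_trans (normr_ge0 _) (hM 0).
  have [xK|xK] := boolP (x \in _).
    rewrite mulr1 (le_trans (ler_normB _ _))// mulr_natl mulr2n lerD//.
  have {xK}xK : K < `|x|.
    rewrite ltNge; apply: contra xK => xK.
    by rewrite inE/= in_itv/= -ler_norml.
  rewrite hN ?hN ?subrr ?normr0 ?mulr0//.
    rewrite (le_lt_trans (ler_norm _))// (le_lt_trans _ xK)// /K -addrA lerDl addr_ge0//.
  have := lerB_normD x (y n); apply: lt_le_trans.
  rewrite ltrBrDl (le_lt_trans _ xK)// /K addrC -addrA lerD ?ler_norm//.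
move=> _ _; rewrite integral0; apply: cvg_trans; apply: near_eq_cvg; apply: nearW => n /=.
by apply: eq_integral => x _ /=.
Qed.

Let cutoff (n : nat) (x : R) : R := Num.max 0 (1 - `|x| / n.+1%:R).

Let cutoff_ge0 n x : 0 <= cutoff n x.
Proof. by rewrite /cutoff le_max lexx. Qed.

Let cutoff_le1 n x : cutoff n x <= 1.
Proof. by rewrite /cutoff ge_max ler01/= lerBlDl lerDr divr_ge0. Qed.

Let cutoff_out n x : n.+1%:R < `|x| -> cutoff n x = 0.
Proof.
move=> nx; rewrite /cutoff max_l// subr_le0.
by rewrite ler_pdivlMr// mul1r ltW.
Qed.

Let continuous_max1B (z : R) : {for z, continuous (fun z : R => Num.max 0 (1 - z))}.
Proof.
apply: (@continuous_max R R (cst 0) (fun z => 1 - z) z); first exact: cvg_cst.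
by apply: cvgB; [exact: cvg_cst|exact: cvg_id].
Qed.

Let continuous_cutoff n : continuous (cutoff n).
Proof.
move=> x; apply: (@continuous_comp R R R (fun x => `|x| / n.+1%:R) (fun z => Num.max 0 (1 - z)) x).
  by apply: cvgM; [exact: norm_continuous|exact: cvg_cst].
exact: continuous_max1B.
Qed.

Let cvg_cutoff (x : R) : cutoff n x @[n --> \oo] --> (1 : R).
Proof.
have -> : 1 = Num.max 0 (1 - 0) :> R by rewrite subr0 max_r.
have := @continuous_cvg _ R R _ _ (fun n : nat => `|x| / n.+1%:R) (fun z : R => Num.max 0 (1 - z)) 0 (@continuous_max1B 0).
apply.
rewrite -(mulr0 `|x|); apply: cvgM; first exact: cvg_cst.
exact: cvg_harmonic.
Qed.

(** Continuous functions are dense in L1 on bounded intervals; a tent function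
cuts f off near infinity, at small cost in L1, and makes the approximant
continuous on the whole line with compact support. *)
Lemma approximation_continuous_compact (f : R -> R) (e : R) : 0 < e ->
  leb.-integrable setT (EFin \o f) ->
  exists (h : R -> R) (M N : R), [/\ continuous h, (forall x, `|h x| <= M),
    (forall x, N < `|x| -> h x = 0) & (\int[leb]_x `|f x - h x|%:E <= e%:E)%E].
Proof.
move=> e0 intf.
have mf : measurable_fun setT (f : RT -> R).
  by apply/measurable_EFinP; case/integrableP : intf.
have mcut n : measurable_fun setT (cutoff n : RT -> R).
  by apply: continuous_measurable_fun => x; exact: continuous_cutoff.
have e20 : 0 < e / 2 by rewrite divr_gt0.
have [n Hn] : exists n, (\int[leb]_x `|f x * (1 - cutoff n x)|%:E <= (e / 2)%:E)%E.
  suff : (\int[leb]_x `|f x * (1 - cutoff n x)|%:E)%E @[n --> \oo] --> 0%E.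
    move=> /cvge0_exists; apply=> // n.
    by apply: integral_ge0 => x _; rewrite lee_fin.
  have := @dominated_convergence _ _ _ leb setT measurableT
    (fun n x => `|f x * (1 - cutoff n x)|%:E) (cst 0%E) (fun x => `|f x|%:E).
  case.
  - move=> n; apply/measurable_EFinP; apply: measurableT_comp => //.
    by apply: measurable_funM => //; exact: measurable_funB.
  - exact: measurable_cst.
  - apply: aeW => x _; apply: cvg_EFin; first exact: nearW.
    rewrite -[X in _ --> X](@normr0 _ R) -(mulr0 (f x)) -(subrr 1).
    apply: cvg_norm; apply: cvgM; first exact: cvg_cst.
    by apply: cvgB; first exact: cvg_cst.
  - exact: integrable_norm.
  - apply: aeW => x n _ /=; rewrite lee_fin normr_id normrM ler_piMr//.
    by rewrite ger0_norm ?subr_ge0// lerBlDl lerDr.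
  move=> _ _; rewrite integral0; apply: cvg_trans; apply: near_eq_cvg; apply: nearW => n /=.
  by apply: eq_integral => x _ /=.
pose K := `[- n.+1%:R, n.+1%:R : R]%classic.
have mK : measurable (K : set RT) by exact: measurable_itv.
have KP x : (x \in K) = (`|x| <= n.+1%:R) by rewrite mem_setE in_itv/= ler_norml.
have [g_ [cg ig gcvg]] : exists g_ : (R -> R)^nat,
    [/\ forall n, continuous (g_ n),
        forall n, leb.-integrable K (EFin \o g_ n) &
        (\int[leb]_(z in K) `|(f z - g_ n z)%:E|)%E @[n --> \oo] --> 0%E].
  apply: approximation_continuous_integrable => //.
    by rewrite /= lebesgue_measure_itv/=; case: ifP => // _; rewrite -EFinB ltry.
  exact: integrableS intf.
have [m Hm] : exists m, (\int[leb]_(x in K) `|(f x - g_ m x)%:E| <= (e / 2)%:E)%E.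
  apply: (cvge0_exists _ gcvg e20) => k.
  by apply: integral_ge0 => x _; rewrite lee_fin.
have mg : measurable_fun setT (g_ m : RT -> R).
  by apply: continuous_measurable_fun => x; exact: cg.
pose h x := g_ m x * cutoff n x.
have ch : continuous h by move=> x; apply: cvgM; [exact: cg|exact: continuous_cutoff].
have hout x : n.+1%:R < `|x| -> h x = 0 by move=> xn; rewrite /h cutoff_out// mulr0.
have [M hM] : exists M : R, forall x, `|h x| <= M.
  have /compact_bounded[M [_ HM]] : compact (h @` K).
    apply: continuous_compact; last exact: segment_compact.
    exact: continuous_subspaceT.
  exists (`|M| + 1) => x.
  have [xK|xK] := boolP (x \in K); last first.
    by rewrite hout ?normr0 ?addr_ge0// ltNge -KP.
  apply: HM; first by rewrite ltr_pwDr// ler_norm.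
  by exists x => //; exact: set_mem.
exists h, M, n.+1%:R; split => //.
have mfh : measurable_fun setT (fun x : RT => f x * (1 - cutoff n x)).
  by apply: measurable_funM => //; exact: measurable_funB.
have mfg : measurable_fun setT (fun x : RT => f x - g_ m x) by exact: measurable_funB.
rewrite integral_mkcond in Hm.
have mr : measurable_fun setT ((fun x : RT => `|(f x - g_ m x)%:E|%E) \_ K).
  apply/(measurable_restrictT _ _).1 => //; apply: measurable_funTS; apply/measurable_EFinP.
  exact: measurableT_comp.
have r0 x : (0 <= ((fun x : RT => `|(f x - g_ m x)%:E|%E) \_ K) x)%E.
  by rewrite /patch; case: ifP => // _; rewrite lee_fin.
rewrite (splitr e) EFinD; apply: le_trans (leeD Hn Hm).
rewrite -ge0_integralD//.
  apply: ge0_le_integral => //.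
  - apply/measurable_EFinP; apply: measurableT_comp => //; apply: measurable_funB => //.
    exact: measurable_funM.
  - apply: emeasurable_funD => //; apply/measurable_EFinP; exact: measurableT_comp.
  - move=> x _; rewrite /patch KP; case: (leP `|x| n.+1%:R) => xn /=.
      rewrite lee_fin.
      have -> : f x - h x = f x * (1 - cutoff n x) + (f x - g_ m x) * cutoff n x.
        by rewrite /h; ring.
      rewrite (le_trans (ler_normD _ _))// lerD// [X in X <= _]normrM ler_piMr//.
      by rewrite ger0_norm.
    by rewrite hout// cutoff_out// !subr0 mulr1 adde0.
by apply/measurable_EFinP; exact: measurableT_comp.
Qed.

(** The compactly supported case and density: translating is an isometry, so
the approximation error counts twice. *)
Lemma translation_cvg1 (f : R -> R) (y : nat -> R) :
  leb.-integrable setT (EFin \o f) -> y n @[n --> \oo] --> 0 ->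
  (\int[leb]_x `|f (x + y n) - f x|%:E)%E @[n --> \oo] --> 0%E.
Proof.
move=> intf y0.
have mf : measurable_fun setT (f : RT -> R).
  by apply/measurable_EFinP; case/integrableP : intf.
have mS (g : R -> R) c : measurable_fun setT (g : RT -> R) ->
    measurable_fun setT (fun x : RT => g (x + c)).
  by move=> mg; apply: measurableT_comp => //; apply: measurable_funD.
apply/ge0_cvge0P => [n|e e0]; first by apply: integral_ge0 => x _; rewrite lee_fin.
have e30 : 0 < e / 3 by rewrite divr_gt0.
have [h [M [N [ch hM hN fh]]]] := approximation_continuous_compact e30 intf.
have mh : measurable_fun setT (h : RT -> R) by apply: continuous_measurable_fun.
have mfh : measurable_fun setT (fun x : RT => `|f x - h x|%:E).
  by apply/measurable_EFinP; apply: measurableT_comp => //; exact: measurable_funB.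
have := translation_cvg_compact ch hM hN y0.
move=> /ge0_cvge0P => /(_ (fun n => integral_norm_ge0 _ _ _)) cvgh.
apply: filterS (cvgh _ e30) => n H.
have fhy : (\int[leb]_x `|f (x + y n) - h (x + y n)|%:E <= (e / 3)%:E)%E.
  move: fh; rewrite (ge0_integral_affine1 (y n) ltr01 mfh); last by move=> x; rewrite lee_fin.
  by rewrite mul1e; under eq_integral do rewrite mul1r (addrC (y n)).
rewrite (_ : e = e / 3 + e / 3 + e / 3); last by field.
rewrite !EFinD.
apply: le_trans (leeD (leeD fhy H) fh).
have m1 : measurable_fun setT (fun x : RT => `|f (x + y n) - h (x + y n)|%:E).
  apply/measurable_EFinP; apply: measurableT_comp => //.
  by apply: measurable_funB; [exact: mS|exact: mS].
have m2 : measurable_fun setT (fun x : RT => `|h (x + y n) - h x|%:E).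
  apply/measurable_EFinP; apply: measurableT_comp => //.
  by apply: measurable_funB => //; exact: mS.
rewrite -ge0_integralD//.
rewrite -ge0_integralD//; last exact: emeasurable_funD.
apply: ge0_le_integral => //.
- apply/measurable_EFinP; apply: measurableT_comp => //.
  by apply: measurable_funB => //; exact: mS.
- by apply: emeasurable_funD => //; exact: emeasurable_funD.
- move=> x _; rewrite -!EFinD lee_fin.
  have -> : f (x + y n) - f x = (f (x + y n) - h (x + y n)) + (h (x + y n) - h x) + - (f x - h x).
    by ring.
  rewrite (le_trans (ler_normD _ _))// normrN lerD//.
  exact: ler_normD.
- by move=> x _; rewrite -EFinD lee_fin.
Qed.

End translation1.

Lemma ge0_integral_shift1 {R : realType} (c : R) (F : R -> \bar R) :
  measurable_fun setT (F : measurableTypeR R -> \bar R) -> (forall x, 0 <= F x)%E ->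
  (\int[@lebesgue_measure R]_x F (x + c)%R = \int[@lebesgue_measure R]_x F x)%E.
Proof.
move=> mF F0; rewrite [RHS](ge0_integral_affine1 c ltr01 mF F0) mul1e.
by apply: eq_integral => x _; rewrite mul1r addrC.
Qed.

Lemma measurable_normB {R : realType} {disp : measure_display}
    {T : measurableType disp} (D : set T) (g h : T -> R) :
  measurable_fun D g -> measurable_fun D h ->
  measurable_fun D (fun x => `|g x - h x|%:E).
Proof.
by move=> mg mh; apply/measurable_EFinP; apply: measurableT_comp => //; exact: measurable_funB.
Qed.

(** Continuity of norm-nonincreasing maps tau n on L1(X) carries over to functions of
a further variable s: for almost every s the section is integrable, so the
inner integral tends to 0, and it is dominated by twice the norm of the
section.  With the two factors of R x R^d in turn as X, this gives the
induction step of [translation_cvg]. *)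
Section translation_param.
Context {R : realType} {d1 d2 : measure_display}.
Context {S : measurableType d1} {X : measurableType d2}.
Variables (nu : {sigma_finite_measure set S -> \bar R}).
Variables (m : {sigma_finite_measure set X -> \bar R}).
Variable tau : nat -> X -> X.
Hypothesis mtau : forall n, measurable_fun setT (tau n).
Hypothesis ptau : forall n (g : X -> R), measurable_fun setT g ->
  (\int[m]_x `|g (tau n x)|%:E <= \int[m]_x `|g x|%:E)%E.
Hypothesis ctau : forall g : X -> R, m.-integrable setT (EFin \o g) ->
  (\int[m]_x `|g (tau n x) - g x|%:E)%E @[n --> \oo] --> 0%E.

Lemma translation_cvg_param (F : S * X -> R) :
  (nu \x m)%E.-integrable setT (EFin \o F) ->
  (\int[nu]_s \int[m]_x `|F (s, tau n x) - F (s, x)|%:E)%E @[n --> \oo] --> 0%E.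
Proof.
move=> iF.
have mF : measurable_fun setT F by apply/measurable_EFinP; case/integrableP : iF.
have iFn : (nu \x m)%E.-integrable setT (fun p => `|F p|%:E) by exact: integrable_norm.
have mFt n : measurable_fun setT (fun p : S * X => F (p.1, tau n p.2)).
  apply: measurableT_comp => //; apply/measurable_fun_pairP; split; first exact: measurable_fst.
  exact: measurableT_comp measurable_snd.
have mD n : measurable_fun setT (fun p : S * X => `|F (p.1, tau n p.2) - F p|%:E).
  by apply/measurable_EFinP; apply: measurableT_comp => //; exact: measurable_funB.
have D0 n (p : S * X) : (0 <= `|F (p.1, tau n p.2) - F p|%:E)%E by rewrite lee_fin.
have := @dominated_convergence _ _ _ nu setT measurableT
  (fun n s => \int[m]_x `|F (s, tau n x) - F (s, x)|%:E)%E (cst 0%E)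
  (fun s => 2%:E * \int[m]_x `|F (s, x)|%:E)%E.
case.
- by move=> n; exact: (measurable_fun_fubini_tonelli_F (m2 := m) _ (mD n)).
- exact: measurable_cst.
- apply: filterS (ae_integrable1 iF) => s iFs _.
  exact: (ctau (g := fun x => F (s, x))).
- apply: integrableZl => //; exact: integrable_fubini_F iFn.
- apply: aeW => s n _; rewrite gee0_abs ?integral_norm_ge0//.
  have mFs : measurable_fun setT (fun x => F (s, x)) by exact: measurableT_comp.
  have mFst : measurable_fun setT (fun x => F (s, tau n x)).
    exact: (measurableT_comp mFs (mtau n)).
  rewrite mule_natl mule2n.
  apply: (@le_trans _ _ (\int[m]_x `|F (s, tau n x)|%:E + \int[m]_x `|F (s, x)|%:E)%E); last first.
    by apply: leeD => //; exact: (ptau n mFs).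
  rewrite -ge0_integralD//; try by apply/measurable_EFinP; apply: measurableT_comp.
  apply: ge0_le_integral => //.
  + apply/measurable_EFinP; apply: measurableT_comp => //; exact: measurable_funB.
  + by apply: emeasurable_funD; apply/measurable_EFinP; apply: measurableT_comp.
  + by move=> x _; rewrite -EFinD lee_fin ler_normB.
move=> _ _; rewrite integral0; apply: cvg_trans; apply: near_eq_cvg; apply: nearW => n /=.
by [].
Qed.

End translation_param.

Section translation_rV.
Context {R : realType}.
Local Notation leb := (@lebesgue_measure R).
Local Notation RT := (measurableTypeR R).

(** A translation of R x R^d is a translation of the line followed by one of R^d;
each is handled by [translation_cvg_param], the other coordinate being the
parameter.  Convergence of the shifts is asked coordinate by coordinate. *)
Lemma translation_cvg d (f : 'rV[R]_d -> R) (y : nat -> 'rV[R]_d) :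
  (lebesgue_rV R d).-integrable setT (EFin \o f) ->
  (forall i, y n 0 i @[n --> \oo] --> 0) ->
  (\int[lebesgue_rV R d]_x `|f (x + y n) - f x|%:E)%E @[n --> \oo] --> 0%E.
Proof.
elim: d f y => [|d IH] f y iF y0.
  rewrite (_ : (fun n => _) = cst 0%E); first exact: cvg_cst.
  apply/funext => n; rewrite integral0_eq// => x _.
  by rewrite (_ : x + y n = x) ?subrr ?normr0//; apply/rowP => -[].
have mf : measurable_fun setT f by apply/measurable_EFinP; case/integrableP : iF.
have mS c : measurable_fun setT (fun x : 'rV[R]_d.+1 => f (x + c)).
  by apply: measurableT_comp => //; apply: measurable_addrV => //; exact: measurable_cst.
pose y' n : 'rV[R]_d := \row_i y n 0 (lift 0 i).
pose F (p : RT * 'rV[R]_d) : R := f (cons_rV p).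
have iFp : (leb \x lebesgue_rV R d)%E.-integrable setT (EFin \o F).
  exact: integrable_cons iF.
have mF : measurable_fun setT F by apply/measurable_EFinP; case/integrableP : iFp.
apply: (@ge0_cvge0_le R nat _ _ _
  (fun n => \int[leb]_s \int[lebesgue_rV R d]_x `|F (s, x + y' n) - F (s, x)|%:E)%E
  (fun n => \int[lebesgue_rV R d]_x \int[leb]_s `|F (s + y n 0 0, x) - F (s, x)|%:E)%E).
- by move=> n; exact: integral_norm_ge0.
- move=> n.
  have mp1 : measurable_fun setT (fun p : RT * 'rV[R]_d => `|F (p.1, p.2 + y' n) - F (p.1, p.2)|%:E).
    apply/measurable_EFinP; apply: measurableT_comp => //; apply: measurable_funB.
      apply: measurableT_comp => //; apply/measurable_fun_pairP; split; first exact: measurable_fst.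
      by apply: measurable_addrV; [exact: measurable_snd|exact: measurable_cst].
    by under eq_fun do rewrite -surjective_pairing.
  have mpy : measurable_fun setT (fun p : RT * 'rV[R]_d => (p.1 + y n 0 0, p.2) : RT * 'rV[R]_d).
    apply/measurable_fun_pairP; split; last exact: measurable_snd.
    by apply: measurable_funD; [exact: measurable_fst|exact: measurable_cst].
  have mp1y : measurable_fun setT
     (fun p : RT * 'rV[R]_d => `|F (p.1 + y n 0 0, p.2 + y' n) - F (p.1 + y n 0 0, p.2)|%:E).
    exact: (measurableT_comp mp1 mpy).
  have mp2 : measurable_fun setT (fun p : RT * 'rV[R]_d => `|F (p.1 + y n 0 0, p.2) - F (p.1, p.2)|%:E).
    apply/measurable_EFinP; apply: measurableT_comp => //; apply: measurable_funB.
      exact: (measurableT_comp mF mpy).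
    by under eq_fun do rewrite -surjective_pairing.
  have mG : measurable_fun setT (fun s : RT =>
      \int[lebesgue_rV R d]_x `|F (s, x + y' n) - F (s, x)|%:E)%E.
    apply: (measurable_fun_fubini_tonelli_F (m2 := lebesgue_rV R d) _ mp1) => p.
    by rewrite lee_fin.
  have mGy : measurable_fun setT (fun s : RT =>
      \int[lebesgue_rV R d]_x `|F (s + y n 0 0, x + y' n) - F (s + y n 0 0, x)|%:E)%E.
    apply: (measurable_fun_fubini_tonelli_F (m2 := lebesgue_rV R d) _ mp1y) => p.
    by rewrite lee_fin.
  have mG2 : measurable_fun setT (fun s : RT =>
      \int[lebesgue_rV R d]_x `|F (s + y n 0 0, x) - F (s, x)|%:E)%E.
    apply: (measurable_fun_fubini_tonelli_F (m2 := lebesgue_rV R d) _ mp2) => p.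
    by rewrite lee_fin.
  rewrite -(fubini_tonelli (fun p : RT * 'rV[R]_d => `|F (p.1 + y n 0 0, p.2) - F (p.1, p.2)|%:E) mp2)//.
  rewrite -(ge0_integral_shift1 (y n 0 0) mG); last by move=> s; exact: integral_norm_ge0.
  rewrite -ge0_integralD//; last 2 first.
    by move=> s _; exact: integral_norm_ge0.
    by move=> s _; exact: integral_norm_ge0.
  rewrite ge0_integral_cons//; last exact: measurable_normB.
  have fE s x : f (cons_rV (s, x) + y n) = F (s + y n 0 0, x + y' n).
    rewrite /F addrC -(scale1r (cons_rV _)) cons_rVE_affine mul1r scale1r.
    by rewrite (addrC s) (addrC x).
  have m1 s : measurable_fun setT (fun x : 'rV[R]_d => F (s, x)) by exact: measurableT_comp.
  have m2 s : measurable_fun setT (fun x : 'rV[R]_d => F (s, x + y' n)).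
    by apply: (measurableT_comp (m1 s)); apply: measurable_addrV => //; exact: measurable_cst.
  apply: ge0_le_integral => //.
  + by move=> s _; exact: integral_norm_ge0.
  + apply: (measurable_fun_fubini_tonelli_F (m2 := lebesgue_rV R d)
      (fun p : RT * 'rV[R]_d => `|f (cons_rV p + y n) - f (cons_rV p)|%:E)) => //.
    apply: (measurableT_comp (f := fun z : 'rV[R]_d.+1 => `|f (z + y n) - f z|%:E) _ (@measurable_consT R d)).
    exact: measurable_normB.
  + exact: emeasurable_funD.
  + move=> s _ /=; rewrite -ge0_integralD//; try exact: measurable_normB.
    apply: ge0_le_integral => //.
    * by under eq_fun do rewrite fE; apply: measurable_normB; [exact: m2|exact: m1].
    * by apply: emeasurable_funD; exact: measurable_normB.
    * move=> x _; rewrite fE -EFinD lee_fin.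
      exact: ler_distD.
- apply: translation_cvg_param => //.
  + by move=> n; apply: measurable_addrV => //; exact: measurable_cst.
  + move=> n g mg; rewrite (ge0_integral_shift (y' n) (F := fun x => `|g x|%:E))//.
    by apply/measurable_EFinP; exact: measurableT_comp.
  + by move=> g ig; apply: IH => // i; rewrite /y'; under eq_fun do rewrite mxE; exact: y0.
- apply: (@translation_cvg_param R _ _ _ RT (lebesgue_rV R d) leb
    (fun n s => s + y n 0 0) _ _ _ (fun p => F (p.2, p.1))).
  + by move=> n; apply: measurable_funD => //; exact: measurable_cst.
  + move=> n g mg.
    rewrite (ge0_integral_shift1 (y n 0 0) (F := fun x => `|g x|%:E))//.
    by apply/measurable_EFinP; exact: measurableT_comp.
  + by move=> g ig; exact: translation_cvg1.
  + have mF2 : measurable_fun setT (EFin \o (fun p : 'rV[R]_d * RT => F (p.2, p.1))).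
      apply/measurable_EFinP; apply: measurableT_comp => //.
      by apply/measurable_fun_pairP; split; [exact: measurable_snd|exact: measurable_fst].
    apply/integrable12ltyP => //.
    by have /integrable21ltyP := iFp; apply; apply/measurable_EFinP.
Qed.

End translation_rV.

(** * Marginals and the L1 seminorm *)
Section marginal.
Context {R : realType} {d1 d2 : measure_display}.
Context {X : measurableType d1} {W : measurableType d2}.
Variables (mu : {sigma_finite_measure set X -> \bar R}).
Variables (nu : {sigma_finite_measure set W -> \bar R}).
Implicit Types H : X * W -> R.

(** Equal to the marginal of H for almost every x only: where the section is not
integrable the value is a default one. *)
Definition marginal H (x : X) : R := \int[nu]_w H (x, w).

Lemma EFin_marginal H : (mu \x nu)%E.-integrable setT (EFin \o H) ->
  {ae mu, forall x, (marginal H x)%:E = (\int[nu]_w (H (x, w))%:E)%E}.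
Proof.
move=> iH; apply: filterS (ae_integrable1 iH) => x iHx.
by rewrite /marginal /Rintegral fineK//; exact: integrable_fin_num.
Qed.

Lemma measurable_marginal H : (mu \x nu)%E.-integrable setT (EFin \o H) ->
  measurable_fun setT (marginal H).
Proof.
move=> iH; apply: (measurableT_comp (fine_measurable measurableT)).
exact: measurable_fubini_F iH.
Qed.

Lemma marginal_norm_le H : (mu \x nu)%E.-integrable setT (EFin \o H) ->
  (\int[mu]_x `|marginal H x|%:E <= \int[nu]_w \int[mu]_x `|H (x, w)|%:E)%E.
Proof.
move=> iH; have /measurable_EFinP mH : measurable_fun setT (EFin \o H).
  by case/integrableP : iH.
have mnH : measurable_fun setT (fun p => `|H p|%:E).
  by apply/measurable_EFinP; exact: measurableT_comp.
rewrite -(fubini_tonelli (fun p => `|H p|%:E)) //.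
apply: ae_ge0_le_integral => //.
- by apply/measurable_EFinP; apply: measurableT_comp => //; exact: measurable_marginal.
- by move=> x _; exact: integral_norm_ge0.
- exact: (measurable_fun_fubini_tonelli_F (m2 := nu) _ mnH).
- apply: filterS (EFin_marginal iH) => x xH _.
  rewrite -abse_EFin xH; apply: le_trans (le_abse_integral _ measurableT _) _.
    by apply/measurable_EFinP; exact: measurableT_comp.
  by [].
Qed.

Lemma integrable_marginal H : (mu \x nu)%E.-integrable setT (EFin \o H) ->
  mu.-integrable setT (EFin \o marginal H).
Proof.
move=> iH; have mH : measurable_fun setT (EFin \o H) by case/integrableP : iH.
apply/integrableP; split; first exact/measurable_EFinP/measurable_marginal.
apply: le_lt_trans (marginal_norm_le iH) _.
exact/(integrable21ltyP mu nu mH).1.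
Qed.

(** The marginal is additive at the points where both sections are integrable,
hence almost everywhere, so this reduces to the bound for H1 - H2. *)
Lemma marginal_normB_le H1 H2 :
  (mu \x nu)%E.-integrable setT (EFin \o H1) ->
  (mu \x nu)%E.-integrable setT (EFin \o H2) ->
  (\int[mu]_x `|marginal H1 x - marginal H2 x|%:E <=
   \int[nu]_w \int[mu]_x `|H1 (x, w) - H2 (x, w)|%:E)%E.
Proof.
move=> iH1 iH2.
have iB : (mu \x nu)%E.-integrable setT (EFin \o (H1 \- H2)).
  exact: (integrableB measurableT iH1 iH2).
apply: le_trans (marginal_norm_le iB).
apply: ae_ge0_le_integral => //.
- by apply: measurable_normB; exact: measurable_marginal.
- by apply/measurable_EFinP; apply: measurableT_comp => //; exact: measurable_marginal.
apply: filterS2 (ae_integrable1 iH1) (ae_integrable1 iH2) => x i1 i2 _.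
by rewrite /marginal RintegralB.
Qed.

(** Fubini's theorem for c H.  The weight c will be the cosine or the sine of a
Fourier transform. *)
Lemma Rintegral_marginal (c : X -> R) H : measurable_fun setT c ->
  (forall x, `|c x| <= 1) -> (mu \x nu)%E.-integrable setT (EFin \o H) ->
  \int[mu]_x (c x * marginal H x) = \int[nu]_w \int[mu]_x (c x * H (x, w)).
Proof.
move=> mc c1 iH; have /measurable_EFinP mH : measurable_fun setT (EFin \o H).
  by case/integrableP : iH.
pose H' p := c p.1 * H p.
have mH' : measurable_fun setT (EFin \o H').
  apply/measurable_EFinP; apply: measurable_funM => //.
  exact: measurableT_comp measurable_fst.
have iH' : (mu \x nu)%E.-integrable setT (EFin \o H').
  apply: le_integrable iH => // p _ /=.
  by rewrite lee_fin /H' normrM ler_piMl.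
transitivity (fine (\int[mu]_x \int[nu]_w (H' (x, w))%:E)%E).
  congr fine; apply: ae_eq_integral => //.
  - by apply/measurable_EFinP; apply: measurable_funM => //; exact: measurable_marginal.
  - exact: measurable_fubini_F iH'.
  apply: filterS2 (ae_integrable1 iH) (EFin_marginal iH') => x i1 i2 _.
  by rewrite -i2 /marginal /H' -RintegralZl.
rewrite (Fubini iH'); congr fine; apply: ae_eq_integral => //.
- exact: measurable_fubini_G iH'.
- apply/measurable_EFinP; apply: (measurableT_comp (fine_measurable measurableT)).
  exact: measurable_fubini_G iH'.
apply: filterS (ae_integrable2 iH') => w iw _.
by rewrite /Rintegral fineK//; exact: integrable_fin_num.
Qed.

End marginal.

Section l1norm.
Context {R : realType} {d : nat}.
Local Notation mu := (lebesgue_rV R d).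
Implicit Types g h : 'rV[R]_d -> R.

Definition l1norm g : \bar R := (\int[mu]_x `|g x|%:E)%E.

Lemma l1norm_ge0 g : (0 <= l1norm g)%E.
Proof. exact: integral_norm_ge0. Qed.

Lemma l1norm_lty g : mu.-integrable setT (EFin \o g) -> (l1norm g < +oo)%E.
Proof. by case/integrableP. Qed.

Lemma l1norm_fin g : mu.-integrable setT (EFin \o g) -> l1norm g \is a fin_num.
Proof. by move=> /l1norm_lty; rewrite ge0_fin_numE// l1norm_ge0. Qed.

Lemma l1norm_measurable g : mu.-integrable setT (EFin \o g) -> measurable_fun setT g.
Proof. by case/integrableP => /measurable_EFinP. Qed.

Lemma l1norm_add_le (f g h : 'rV[R]_d -> R) : measurable_fun setT f ->
  measurable_fun setT g -> measurable_fun setT h ->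
  (forall x, `|f x| <= `|g x| + `|h x|) ->
  (l1norm f <= l1norm g + l1norm h)%E.
Proof.
move=> mf mg mh fgh.
have mn (k : 'rV[R]_d -> R) : measurable_fun setT k -> measurable_fun setT (fun x : 'rV[R]_d => `|k x|%:E).
  by move=> mk; apply/measurable_EFinP; exact: measurableT_comp.
rewrite /l1norm -ge0_integralD//; [|exact: mn|exact: mn].
apply: ge0_le_integral => //; [exact: mn|by apply: emeasurable_funD; exact: mn|].
by move=> x _; rewrite -EFinD lee_fin.
Qed.

(** The L1 modulus of continuity of g. *)
Definition l1modulus g (y : 'rV[R]_d) : \bar R := l1norm (fun x => g (x + y) - g x).

Lemma l1modulus_ge0 g y : (0 <= l1modulus g y)%E.
Proof. exact: l1norm_ge0. Qed.

Lemma measurable_shift g y : measurable_fun setT g ->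
  measurable_fun setT (fun x : 'rV[R]_d => g (x + y)).
Proof.
by move=> mg; apply: measurableT_comp => //; apply: measurable_addrV => //; exact: measurable_cst.
Qed.

Lemma l1norm_shift g y : measurable_fun setT g -> l1norm (fun x => g (x + y)) = l1norm g.
Proof.
move=> mg; rewrite /l1norm (ge0_integral_shift y (F := fun x => `|g x|%:E))//.
by apply/measurable_EFinP; exact: measurableT_comp.
Qed.

Lemma l1modulus_le g y : measurable_fun setT g ->
  (l1modulus g y <= 2%:E * l1norm g)%E.
Proof.
move=> mg; rewrite mule_natl mule2n -{1}(l1norm_shift y mg).
apply: l1norm_add_le => //; last by move=> x; exact: ler_normB.
  by apply: measurable_funB => //; exact: measurable_shift.
exact: measurable_shift.
Qed.

Lemma ler_coord_enorm (y : 'rV[R]_d) i : `|y 0 i| <= enorm y.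
Proof.
rewrite /enorm /dot mxE -sqrtr_sqr ler_wsqrtr// (bigD1 i)//= mxE -expr2 lerDl.
by apply: sumr_ge0 => j _; rewrite mxE -expr2 sqr_ge0.
Qed.

(** Otherwise a sequence of shifts tending to 0 would keep the modulus away from 0,
against [translation_cvg]. *)
Lemma l1modulus_small g (e : R) : mu.-integrable setT (EFin \o g) -> 0 < e ->
  exists2 a : R, 0 < a & forall y, enorm y <= a -> (l1modulus g y <= e%:E)%E.
Proof.
move=> ig e0; apply: contrapT => /forall2NP H.
have {}H n : exists y, enorm y <= n.+1%:R^-1 /\ (e%:E < l1modulus g y)%E.
  have [|] := H n.+1%:R^-1; first by rewrite invr_gt0 ltr0n.
  move=> /existsNP[y /not_implyP[yn /negP]]; rewrite -ltNge => ey.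
  by exists y.
have [y yP] := choice H.
have : (l1modulus g (y n))%E @[n --> \oo] --> 0%E.
  apply: (translation_cvg ig) => i.
  apply/norm_cvg0P.
  apply: (@squeeze_cvgr _ _ _ _ (cst 0) (fun n => n.+1%:R^-1)); last exact: cvg_harmonic.
  - by apply: nearW => n; rewrite normr_ge0/= (le_trans (ler_coord_enorm _ _))//; case: (yP n).
  - exact: cvg_cst.
move=> /cvge0_exists => /(_ (fun n => l1modulus_ge0 _ _) e e0)[n].
by case: (yP n) => _; rewrite ltNge => /negP.
Qed.

End l1norm.

(** * Random shifts and the real Fourier transform *)
Section Rintegral_affine.
Context {R : realType} {d : nat}.
Local Notation mu := (lebesgue_rV R d).

Lemma integrable_affine (c : 'rV[R]_d) (e : R) (F : 'rV[R]_d -> R) : 0 < e ->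
  mu.-integrable setT (EFin \o F) ->
  mu.-integrable setT (EFin \o (fun x => F (c + e *: x))).
Proof.
move=> e0 iF; have mF := l1norm_measurable iF.
apply/integrableP; split.
  by apply/measurable_EFinP; apply: measurableT_comp => //; exact: measurable_affine_rV.
have := l1norm_lty iF; rewrite /l1norm (ge0_integral_affine c e0)//; last first.
  by apply/measurable_EFinP; exact: measurableT_comp.
have ed0 : 0 < e ^+ d by exact: exprn_gt0.
by rewrite !ltey; apply: contra => /eqP ->; rewrite gt0_muley// lte_fin.
Qed.

Lemma Rintegral_affine (c : 'rV[R]_d) (e : R) (F : 'rV[R]_d -> R) : 0 < e ->
  mu.-integrable setT (EFin \o F) ->
  \int[mu]_x F (c + e *: x) = (e ^+ d)^-1 * \int[mu]_x F x.
Proof.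
move=> e0 iF; have mF := l1norm_measurable iF.
have ed0 : 0 < e ^+ d by exact: exprn_gt0.
have iG := integrable_affine c e0 iF.
suff -> : \int[mu]_x F x = e ^+ d * \int[mu]_x F (c + e *: x).
  by rewrite mulrA mulVf ?mul1r// gt_eqF.
have mE : measurable_fun setT (EFin \o F) by exact/measurable_EFinP.
rewrite /Rintegral -[e ^+ d]/(fine (e ^+ d)%:E) -fineM//; last exact: integrable_fin_num.
congr fine; rewrite integralE [in RHS]integralE.
rewrite muleBr//; last first.
  rewrite fin_num_adde_defr//.
  exact: (integrable_pos_fin_num measurableT iG).
congr (_ - _)%E.
  rewrite (ge0_integral_affine c e0 (measurable_funepos mE)); last by move=> x; exact: funepos_ge0.
  by congr (_ * _)%E; apply: eq_integral => x _; rewrite !funeposE.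
rewrite (ge0_integral_affine c e0 (measurable_funeneg mE)); last by move=> x; exact: funeneg_ge0.
by congr (_ * _)%E; apply: eq_integral => x _; rewrite !funenegE.
Qed.

End Rintegral_affine.

Section shift_mean.
Context {R : realType} {d : nat} {disp : measure_display} {W : measurableType disp}.
Variable nu : {sigma_finite_measure set W -> \bar R}.
Local Notation mu := (lebesgue_rV R d).
Implicit Types (rho : W -> R) (Y Z : W -> 'rV[R]_d) (g : 'rV[R]_d -> R).

(** The average of the translates of g by Y with weight rho.  With rho = 1 on a
probability space it is the semigroup of a process; with Y w = e w on R^d and
rho a kernel it is a mollification. *)
Definition shift_mean rho Y g (x : 'rV[R]_d) : R :=
  \int[nu]_w (rho w * g (x + Y w)).

Lemma measurable_shift_mean_integrand rho Y g :
  measurable_fun setT rho -> measurable_fun setT Y -> measurable_fun setT g ->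
  measurable_fun setT (fun p : 'rV[R]_d * W => rho p.2 * g (p.1 + Y p.2)).
Proof.
move=> mrho mY mg; apply: measurable_funM.
  exact: (measurableT_comp mrho measurable_snd).
apply: (measurableT_comp mg); apply: measurable_addrV; first exact: measurable_fst.
exact: (measurableT_comp mY measurable_snd).
Qed.

Lemma integrable_shift_mean_integrand rho Y g :
  nu.-integrable setT (EFin \o rho) -> measurable_fun setT Y ->
  mu.-integrable setT (EFin \o g) ->
  (mu \x nu)%E.-integrable setT
    (EFin \o (fun p : 'rV[R]_d * W => rho p.2 * g (p.1 + Y p.2))).
Proof.
move=> irho mY ig; have mg := l1norm_measurable ig.
have /integrableP[/measurable_EFinP mrho rhoy] := irho.
apply/integrable21ltyP.
  by apply/measurable_EFinP; exact: (measurable_shift_mean_integrand mrho mY mg).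
have -> : (\int[nu]_w \int[mu]_x `|(rho w * g (x + Y w))%:E| =
    (\int[nu]_w `|rho w|%:E) * l1norm g)%E.
  rewrite -ge0_integralZr//; last 2 first.
    by apply/measurable_EFinP; exact: measurableT_comp.
    exact: l1norm_ge0.
  apply: eq_integral => w _.
  under eq_integral => x _ do rewrite abse_EFin normrM EFinM.
  rewrite ge0_integralZl//; last first.
    by apply/measurable_EFinP; apply: measurableT_comp => //; exact: measurable_shift.
  by rewrite -[X in (_ * X)%E]/(l1norm (fun x => g (x + Y w))) l1norm_shift.
by rewrite lte_mul_pinfty// ?integral_norm_ge0// ?l1norm_lty// ge0_fin_numE// integral_norm_ge0.
Qed.

Lemma integrable_shift_mean rho Y g :
  nu.-integrable setT (EFin \o rho) -> measurable_fun setT Y ->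
  mu.-integrable setT (EFin \o g) ->
  mu.-integrable setT (EFin \o shift_mean rho Y g).
Proof.
by move=> irho mY ig; exact: (integrable_marginal (integrable_shift_mean_integrand irho mY ig)).
Qed.

Lemma l1norm_shift_mean_le rho Y g :
  nu.-integrable setT (EFin \o rho) -> measurable_fun setT Y ->
  mu.-integrable setT (EFin \o g) ->
  (l1norm (shift_mean rho Y g) <= (\int[nu]_w `|rho w|%:E) * l1norm g)%E.
Proof.
move=> irho mY ig; have mg := l1norm_measurable ig.
have /integrableP[/measurable_EFinP mrho rhoy] := irho.
apply: le_trans (marginal_norm_le (integrable_shift_mean_integrand irho mY ig)) _.
rewrite -ge0_integralZr//; last 2 first.
  by apply/measurable_EFinP; exact: measurableT_comp.
  exact: l1norm_ge0.
rewrite le_eqVlt; apply/orP; left; apply/eqP; apply: eq_integral => w _.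
under eq_integral => x _ do rewrite /= normrM EFinM.
rewrite ge0_integralZl//; last first.
  by apply/measurable_EFinP; apply: measurableT_comp => //; exact: measurable_shift.
by rewrite -[X in (_ * X)%E]/(l1norm (fun x => g (x + Y w))) l1norm_shift.
Qed.

(** Minkowski's inequality: for each w, the translates of g by Y w and by Z w are
at the distance given by the modulus of g at Y w - Z w. *)
Lemma l1norm_shift_meanB_le rho Y Z g :
  nu.-integrable setT (EFin \o rho) -> measurable_fun setT Y -> measurable_fun setT Z ->
  mu.-integrable setT (EFin \o g) ->
  (l1norm (fun x => shift_mean rho Y g x - shift_mean rho Z g x)%R <=
   \int[nu]_w (`|rho w|%:E * l1modulus g (Y w - Z w)%R))%E.
Proof.
move=> irho mY mZ ig; have mg := l1norm_measurable ig.
apply: le_trans (marginal_normB_le (integrable_shift_mean_integrand irho mY ig)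
  (integrable_shift_mean_integrand irho mZ ig)) _.
rewrite le_eqVlt; apply/orP; left; apply/eqP; apply: eq_integral => w _.
under eq_integral => x _ do rewrite /= -mulrBr normrM EFinM.
have mgYZ : measurable_fun setT (fun x : 'rV[R]_d => g (x + Y w) - g (x + Z w)).
  by apply: measurable_funB; exact: measurable_shift.
have mgD : measurable_fun setT (fun x : 'rV[R]_d => g (x + (Y w - Z w)) - g x).
  by apply: measurable_funB => //; exact: measurable_shift.
rewrite ge0_integralZl//; last first.
  by apply/measurable_EFinP; exact: measurableT_comp.
congr (_ * _)%E; rewrite /l1modulus -(l1norm_shift (Z w) mgD).
by apply: eq_integral => x _; rewrite -addrA (addrC (Z w)) subrK.
Qed.

End shift_mean.

Lemma integrable_bounded_mul {R : realType} {disp' : measure_display} {T : measurableType disp'}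
    (m : {measure set T -> \bar R}) (c f : T -> R) :
  measurable_fun setT c -> (forall x, `|c x| <= 1) -> m.-integrable setT (EFin \o f) ->
  m.-integrable setT (EFin \o (fun x => c x * f x)).
Proof.
move=> mc c1 iF; have /measurable_EFinP mf : measurable_fun setT (EFin \o f).
  by case/integrableP : iF.
apply: le_integrable iF => //; first by apply/measurable_EFinP; exact: measurable_funM.
by move=> x _ /=; rewrite lee_fin normrM ler_piMl.
Qed.

Section fourier_real.
Context {R : realType} {d : nat}.
Local Notation mu := (lebesgue_rV R d).
Implicit Types (g h : 'rV[R]_d -> R) (k x y : 'rV[R]_d).

(** The real part and the opposite of the imaginary part of [fourier g k]: working
with two real integrals keeps all limits and estimates real. *)
Definition fcos g k : R := \int[mu]_x (cos (dot k x) * g x).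
Definition fsin g k : R := \int[mu]_x (sin (dot k x) * g x).

Lemma dotDr k x y : dot k (x + y) = dot k x + dot k y.
Proof. by rewrite /dot linearD/= mulmxDr mxE. Qed.

Lemma dotZr k (e : R) x : dot k (e *: x) = e * dot k x.
Proof. by rewrite /dot linearZ/= -scalemxAr mxE. Qed.

Lemma dotZl k (e : R) x : dot (e *: k) x = e * dot k x.
Proof. by rewrite /dot -scalemxAl mxE. Qed.

Lemma measurable_cos_dot k : measurable_fun setT (fun x => cos (dot k x)).
Proof.
apply: (measurableT_comp (continuous_measurable_fun (@continuous_cos R))).
by apply: measurable_dotrV => //; exact: measurable_cst.
Qed.

Lemma measurable_sin_dot k : measurable_fun setT (fun x => sin (dot k x)).
Proof.
apply: (measurableT_comp (continuous_measurable_fun (@continuous_sin R))).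
by apply: measurable_dotrV => //; exact: measurable_cst.
Qed.

Lemma normr_cos_le1 (t : R) : `|cos t| <= 1.
Proof. by rewrite ler_norml cos_geN1 cos_le1. Qed.

Lemma normr_sin_le1 (t : R) : `|sin t| <= 1.
Proof. by rewrite ler_norml sin_geN1 sin_le1. Qed.

Lemma integrable_cos_mul g k : mu.-integrable setT (EFin \o g) ->
  mu.-integrable setT (EFin \o (fun x => cos (dot k x) * g x)).
Proof.
apply: integrable_bounded_mul; first exact: measurable_cos_dot.
by move=> x; exact: normr_cos_le1.
Qed.

Lemma integrable_sin_mul g k : mu.-integrable setT (EFin \o g) ->
  mu.-integrable setT (EFin \o (fun x => sin (dot k x) * g x)).
Proof.
apply: integrable_bounded_mul; first exact: measurable_sin_dot.
by move=> x; exact: normr_sin_le1.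
Qed.

Lemma cexpNi_mul (t y : R) :
  cexp (- (t*i)) * y%:C = (cos t * y) +i* (- (sin t * y)).
Proof.
rewrite /cexp /=; simpc; rewrite ?oppr0 expR0 !mul1r cosN sinN.
by rewrite mulNr.
Qed.

Lemma cexpi (t : R) : cexp (t*i) = cos t +i* sin t.
Proof. by rewrite /cexp /=; simpc; rewrite expR0 !mul1r. Qed.

Lemma fourierE g k : mu.-integrable setT (EFin \o g) ->
  fourier g k = fcos g k +i* - fsin g k.
Proof.
move=> ig; rewrite /fourier /cintegral; congr Complex.
  by apply: eq_Rintegral => x _; rewrite cexpNi_mul.
rewrite /fsin -mulN1r -RintegralZl//; last exact: integrable_sin_mul.
by apply: eq_Rintegral => x _; rewrite cexpNi_mul/= mulN1r.
Qed.

Lemma fcosB g h k : mu.-integrable setT (EFin \o g) -> mu.-integrable setT (EFin \o h) ->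
  fcos (fun x => g x - h x) k = fcos g k - fcos h k.
Proof.
move=> ig ih; rewrite /fcos -RintegralB//; [|exact: integrable_cos_mul..].
by apply: eq_Rintegral => x _; rewrite mulrBr.
Qed.

Lemma fsinB g h k : mu.-integrable setT (EFin \o g) -> mu.-integrable setT (EFin \o h) ->
  fsin (fun x => g x - h x) k = fsin g k - fsin h k.
Proof.
move=> ig ih; rewrite /fsin -RintegralB//; [|exact: integrable_sin_mul..].
by apply: eq_Rintegral => x _; rewrite mulrBr.
Qed.

Lemma fcosD g h k : mu.-integrable setT (EFin \o g) -> mu.-integrable setT (EFin \o h) ->
  fcos (fun x => g x + h x) k = fcos g k + fcos h k.
Proof.
move=> ig ih; rewrite /fcos -RintegralD//; [|exact: integrable_cos_mul..].
by apply: eq_Rintegral => x _; rewrite mulrDr.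
Qed.

Lemma fsinD g h k : mu.-integrable setT (EFin \o g) -> mu.-integrable setT (EFin \o h) ->
  fsin (fun x => g x + h x) k = fsin g k + fsin h k.
Proof.
move=> ig ih; rewrite /fsin -RintegralD//; [|exact: integrable_sin_mul..].
by apply: eq_Rintegral => x _; rewrite mulrDr.
Qed.

Lemma fcosZ g (c : R) k : mu.-integrable setT (EFin \o g) ->
  fcos (fun x => c * g x) k = c * fcos g k.
Proof.
move=> ig; rewrite /fcos -RintegralZl//; last exact: integrable_cos_mul.
by apply: eq_Rintegral => x _; rewrite mulrCA.
Qed.

Lemma fsinZ g (c : R) k : mu.-integrable setT (EFin \o g) ->
  fsin (fun x => c * g x) k = c * fsin g k.
Proof.
move=> ig; rewrite /fsin -RintegralZl//; last exact: integrable_sin_mul.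
by apply: eq_Rintegral => x _; rewrite mulrCA.
Qed.

Lemma fcos_norm_le g k : mu.-integrable setT (EFin \o g) ->
  (`|fcos g k|%:E <= l1norm g)%E.
Proof.
move=> ig; rewrite EFin_normr_Rintegral//; last exact: integrable_cos_mul.
have mg := l1norm_measurable ig.
apply: le_trans (le_abse_integral _ measurableT _) _.
  by case/integrableP : (integrable_cos_mul k ig).
apply: ge0_le_integral => //.
- by apply: measurableT_comp => //; case/integrableP : (integrable_cos_mul k ig).
- by apply/measurable_EFinP; exact: measurableT_comp.
- by move=> x _ /=; rewrite lee_fin normrM ler_piMl// normr_cos_le1.
Qed.

Lemma fsin_norm_le g k : mu.-integrable setT (EFin \o g) ->
  (`|fsin g k|%:E <= l1norm g)%E.
Proof.
move=> ig; rewrite EFin_normr_Rintegral//; last exact: integrable_sin_mul.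
have mg := l1norm_measurable ig.
apply: le_trans (le_abse_integral _ measurableT _) _.
  by case/integrableP : (integrable_sin_mul k ig).
apply: ge0_le_integral => //.
- by apply: measurableT_comp => //; case/integrableP : (integrable_sin_mul k ig).
- by apply/measurable_EFinP; exact: measurableT_comp.
- by move=> x _ /=; rewrite lee_fin normrM ler_piMl// normr_sin_le1.
Qed.

(** Substitute x - y for x and expand the cosine of a difference. *)
Lemma fcos_shift g y k : mu.-integrable setT (EFin \o g) ->
  \int[mu]_x (cos (dot k x) * g (x + y)) =
  cos (dot k y) * fcos g k + sin (dot k y) * fsin g k.
Proof.
move=> ig.
pose F x := cos (dot k y) * (cos (dot k x) * g x) + sin (dot k y) * (sin (dot k x) * g x).
have i1 := integrable_cos_mul k ig; have i2 := integrable_sin_mul k ig.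
have i1' : mu.-integrable setT (EFin \o (fun x => cos (dot k y) * (cos (dot k x) * g x))).
  exact: (integrableZl measurableT _ i1).
have i2' : mu.-integrable setT (EFin \o (fun x => sin (dot k y) * (sin (dot k x) * g x))).
  exact: (integrableZl measurableT _ i2).
have iF : mu.-integrable setT (EFin \o F) by exact: (integrableD measurableT i1' i2').
rewrite /fcos /fsin -!RintegralZl// -RintegralD//.
have := Rintegral_affine y ltr01 iF; rewrite expr1n invr1 mul1r => <-.
apply: eq_Rintegral => x _; rewrite scale1r /F (addrC y) !mulrA -mulrDl; congr (_ * _).
have -> : dot k x = dot k (x + y) - dot k y by rewrite dotDr addrK.
by rewrite cosB; ring.
Qed.

Lemma fsin_shift g y k : mu.-integrable setT (EFin \o g) ->
  \int[mu]_x (sin (dot k x) * g (x + y)) =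
  cos (dot k y) * fsin g k - sin (dot k y) * fcos g k.
Proof.
move=> ig.
pose F x := cos (dot k y) * (sin (dot k x) * g x) - sin (dot k y) * (cos (dot k x) * g x).
have i1 := integrable_sin_mul k ig; have i2 := integrable_cos_mul k ig.
have i1' : mu.-integrable setT (EFin \o (fun x => cos (dot k y) * (sin (dot k x) * g x))).
  exact: (integrableZl measurableT _ i1).
have i2' : mu.-integrable setT (EFin \o (fun x => sin (dot k y) * (cos (dot k x) * g x))).
  exact: (integrableZl measurableT _ i2).
have iF : mu.-integrable setT (EFin \o F) by exact: (integrableB measurableT i1' i2').
rewrite /fcos /fsin -!RintegralZl// -RintegralB//.
have := Rintegral_affine y ltr01 iF; rewrite expr1n invr1 mul1r => <-.
apply: eq_Rintegral => x _; rewrite scale1r /F (addrC y) !mulrA -mulrBl; congr (_ * _).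
have -> : dot k x = dot k (x + y) - dot k y by rewrite dotDr addrK.
by rewrite sinB; ring.
Qed.

End fourier_real.

Section shift_mean_fourier.
Context {R : realType} {d : nat} {disp : measure_display} {W : measurableType disp}.
Variable nu : {sigma_finite_measure set W -> \bar R}.
Local Notation mu := (lebesgue_rV R d).
Variables (rho : W -> R) (Y : W -> 'rV[R]_d) (g : 'rV[R]_d -> R).
Hypothesis irho : nu.-integrable setT (EFin \o rho).
Hypothesis mY : measurable_fun setT Y.
Hypothesis ig : mu.-integrable setT (EFin \o g).

Let mcosY k : measurable_fun setT (fun w => cos (dot k (Y w))).
Proof. exact: (measurableT_comp (measurable_cos_dot k) mY). Qed.

Let msinY k : measurable_fun setT (fun w => sin (dot k (Y w))).
Proof. exact: (measurableT_comp (measurable_sin_dot k) mY). Qed.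

Let icosY k : nu.-integrable setT (EFin \o (fun w => cos (dot k (Y w)) * rho w)).
Proof. by apply: integrable_bounded_mul => // w; exact: normr_cos_le1. Qed.

Let isinY k : nu.-integrable setT (EFin \o (fun w => sin (dot k (Y w)) * rho w)).
Proof. by apply: integrable_bounded_mul => // w; exact: normr_sin_le1. Qed.

Let igY y : mu.-integrable setT (EFin \o (fun x => g (x + y))).
Proof.
have := integrable_affine y ltr01 ig.
by under eq_fun do rewrite /= scale1r addrC.
Qed.

(** The transform of an average of translates is the transform of g multiplied by
the characteristic function of Y under the weight rho; this is the real part of
that identity, the next lemma its imaginary part. *)
Lemma fcos_shift_mean k : fcos (shift_mean nu rho Y g) k =
  (\int[nu]_w (cos (dot k (Y w)) * rho w)) * fcos g k +
  (\int[nu]_w (sin (dot k (Y w)) * rho w)) * fsin g k.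
Proof.
rewrite -!RintegralZr// -RintegralD//; last 2 first.
  exact: (integrableZr measurableT _ (icosY k)).
  exact: (integrableZr measurableT _ (isinY k)).
rewrite [LHS](Rintegral_marginal (measurable_cos_dot k) (fun x => normr_cos_le1 _)
  (integrable_shift_mean_integrand irho mY ig)).
apply: eq_Rintegral => w _ /=.
under eq_Rintegral do rewrite mulrCA.
rewrite RintegralZl//; last exact: integrable_cos_mul.
by rewrite fcos_shift//; ring.
Qed.

Lemma fsin_shift_mean k : fsin (shift_mean nu rho Y g) k =
  (\int[nu]_w (cos (dot k (Y w)) * rho w)) * fsin g k -
  (\int[nu]_w (sin (dot k (Y w)) * rho w)) * fcos g k.
Proof.
rewrite -!RintegralZr// -RintegralB//; last 2 first.
  exact: (integrableZr measurableT _ (icosY k)).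
  exact: (integrableZr measurableT _ (isinY k)).
rewrite [LHS](Rintegral_marginal (measurable_sin_dot k) (fun x => normr_sin_le1 _)
  (integrable_shift_mean_integrand irho mY ig)).
apply: eq_Rintegral => w _ /=.
under eq_Rintegral do rewrite mulrCA.
rewrite RintegralZl//; last exact: integrable_sin_mul.
by rewrite fsin_shift//; ring.
Qed.

End shift_mean_fourier.

(** * An explicit Fourier pair *)
Section laplace_kernel1.
Context {R : realType}.
Local Notation leb := (@lebesgue_measure R).
Local Notation RT := (measurableTypeR R).

Definition expNnorm (x : R) : R := expR (- `|x|).
Definition cauchy_kernel (y : R) : R := 2 * (oneDsqr y)^-1.

Lemma expNnorm_ge0 x : 0 <= expNnorm x. Proof. exact: expR_ge0. Qed.

Lemma cauchy_kernel_gt0 y : 0 < cauchy_kernel y.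
Proof. by rewrite /cauchy_kernel mulr_gt0// invr_gt0 (lt_le_trans ltr01)// oneDsqr_ge1. Qed.

(** Adding 1 to the cosine makes the integrand nonnegative, so that the
fundamental theorem of calculus on a half-line applies without an a priori
integrability proof. *)
Let expNcos (y x : R) := expNnorm x * (1 + cos (y * x)).

Let expNcos_ge0 y x : 0 <= expNcos y x.
Proof. by rewrite mulr_ge0 ?expNnorm_ge0// -lerBlDl sub0r cos_geN1. Qed.

Lemma continuous_expNnorm : continuous expNnorm.
Proof.
move=> x; apply: continuous_comp; last exact: continuous_expR.
by apply: cvgN; exact: norm_continuous.
Qed.

Let continuous_expNcos y : continuous (expNcos y).
Proof.
move=> x; apply: cvgM; first exact: continuous_expNnorm.
apply: cvgD; first exact: cvg_cst.
apply: continuous_comp; last exact: continuous_cos.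
by apply: cvgM; [exact: cvg_cst|exact: cvg_id].
Qed.

(** A primitive of [expNcos y] on the positive half-line, where the norm in
[expNnorm] disappears. *)
Let primitive (y x : R) : R :=
  expR (- x) * ((y * sin (y * x) - cos (y * x)) * (oneDsqr y)^-1 - 1).

Let primitive_derive y x :
  is_derive x (1 : R) (primitive y) (expR (- x) * (1 + cos (y * x))).
Proof.
have y0 : oneDsqr y != 0 by rewrite gt_eqF// (lt_le_trans ltr01)// oneDsqr_ge1.
apply: is_derive_eq.
have sc (a b : R) : a *: (b : R^o) = a * b by [].
rewrite !sc; rewrite /oneDsqr in y0 *; field.
exact: y0.
Qed.

Let primitive_cvgy y : primitive y x @[x --> +oo] --> (0 : R).
Proof.
apply/norm_cvg0P.
apply: (@squeeze_cvgr _ _ _ _ (cst 0) (fun x => expR (- x) * (`|y| + 2))).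
- apply: nearW => x; rewrite normr_ge0/= /primitive normrM ger0_norm ?expR_ge0//.
  rewrite ler_wpM2l ?expR_ge0// (le_trans (ler_normB _ _))// normr1.
  rewrite (_ : `|y| + 2 = `|y| + 1 + 1); last by ring.
  rewrite lerD2r normrM.
  apply: le_trans (_ : `|y * sin (y * x) - cos (y * x)| * 1 <= _).
    by rewrite ler_wpM2l// ger0_norm ?oneDsqrV_le1// invr_ge0 (le_trans ler01)// oneDsqr_ge1.
  rewrite mulr1 (le_trans (ler_normB _ _))// lerD ?normr_cos_le1//.
  by rewrite normrM ler_piMr// normr_sin_le1.
- exact: cvg_cst.
- rewrite -(mul0r (`|y| + 2)); apply: cvgM; last exact: cvg_cst.
  exact: cvgr_expR.
Qed.

Lemma integral_expNcos y :
  (\int[leb]_x (expNcos y x)%:E = (2 + cauchy_kernel y)%:E)%E.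
Proof.
have sym : expNcos y =1 expNcos y \o -%R.
  by move=> x /=; rewrite /expNcos /expNnorm normrN mulrN cosN.
rewrite (ge0_symfun_integralT (expNcos_ge0 y) (@continuous_expNcos y) sym).
have -> : [set x : R | 0 <= x] = `[0, +oo[%classic.
  by apply/seteqP; split => x /=; rewrite in_itv/= andbT.
have dP x : derivable (primitive y) x 1 by case: (primitive_derive y x).
rewrite (@ge0_continuous_FTC2y R (expNcos y) (primitive y) 0 0)//.
- rewrite /primitive /cauchy_kernel oppr0 expR0 mulr0 sin0 cos0 mulr0 sub0r mul1r.
  rewrite -EFinB -EFinM; congr EFin; ring.
- by apply: continuous_subspaceT => x; exact: continuous_expNcos.
- apply: cvg_at_right_filter; apply: differentiable_continuous.
  exact/derivable1_diffP.
- move=> x; rewrite in_itv/= andbT => x0.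
  rewrite derive1E (@derive_val _ _ _ _ _ _ _ (primitive_derive y x)).
  by rewrite /expNcos /expNnorm gtr0_norm.
Qed.

(** At y = 0 the previous integral is twice this one. *)
Lemma integral_expNnorm : (\int[leb]_x (expNnorm x)%:E = 2%:E)%E.
Proof.
have H : (2%:E * \int[leb]_x (expNnorm x)%:E = 2%:E * 2%:E)%E.
  have m : measurable_fun setT (expNnorm : RT -> R).
    by apply: continuous_measurable_fun; exact: continuous_expNnorm.
  rewrite -ge0_integralZl//; last 2 first.
    exact/measurable_EFinP.
    by move=> x _; rewrite lee_fin expNnorm_ge0.
  rewrite -EFinM; have -> : 2 * 2 = 2 + cauchy_kernel 0 :> R.
    by rewrite /cauchy_kernel /oneDsqr expr0n/= addr0 invr1; ring.
  rewrite -integral_expNcos; apply: eq_integral => x _.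
  by rewrite /expNcos mul0r cos0 -EFinM mulrC -natr1.
move: H => /(congr1 (fun z => 2^-1%:E * z)%E).
by rewrite !muleA -!EFinM !mulVf// mul1e mul1r.
Qed.

Lemma integrable_expNnorm : leb.-integrable setT (EFin \o expNnorm).
Proof.
apply/integrableP; split.
  by apply/measurable_EFinP; apply: continuous_measurable_fun; exact: continuous_expNnorm.
under eq_integral => x _ do rewrite /= ger0_norm ?expNnorm_ge0//.
by rewrite integral_expNnorm ltry.
Qed.

Let mcos y : measurable_fun setT (fun x : RT => cos (y * x)).
Proof.
apply: (measurableT_comp (continuous_measurable_fun (@continuous_cos R))).
by apply: measurable_funM => //; exact: measurable_cst.
Qed.

Let msin y : measurable_fun setT (fun x : RT => sin (y * x)).
Proof.
apply: (measurableT_comp (continuous_measurable_fun (@continuous_sin R))).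
by apply: measurable_funM => //; exact: measurable_cst.
Qed.

Lemma integrable_cos_expNnorm y :
  leb.-integrable setT (EFin \o (fun x => cos (y * x) * expNnorm x)).
Proof.
apply: integrable_bounded_mul => //; last exact: integrable_expNnorm.
by move=> x; exact: normr_cos_le1.
Qed.

Lemma integrable_sin_expNnorm y :
  leb.-integrable setT (EFin \o (fun x => sin (y * x) * expNnorm x)).
Proof.
apply: integrable_bounded_mul => //; last exact: integrable_expNnorm.
by move=> x; exact: normr_sin_le1.
Qed.

Lemma Rintegral_cos_expNnorm y :
  \int[leb]_x (cos (y * x) * expNnorm x) = cauchy_kernel y.
Proof.
have : \int[leb]_x (expNnorm x + cos (y * x) * expNnorm x) = 2 + cauchy_kernel y.
  rewrite /Rintegral -[RHS]/(fine (2 + cauchy_kernel y)%:E) -integral_expNcos.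
  by congr fine; apply: eq_integral => x _; rewrite /expNcos mulrDr mulr1 mulrC.
rewrite RintegralD//; [|exact: integrable_expNnorm|exact: integrable_cos_expNnorm].
by rewrite {1}/Rintegral integral_expNnorm/= => /addrI.
Qed.

Lemma ge0_integral_opp (F : R -> \bar R) :
  measurable_fun setT (F : RT -> \bar R) -> (forall x, 0 <= F x)%E ->
  (\int[leb]_x F (- x)%R = \int[leb]_x F x)%E.
Proof.
move=> mF F0.
have mN : measurable_fun setT (-%R : RT -> RT).
  by apply: continuous_measurable_fun => x; exact: opp_continuous.
rewrite -[LHS](ge0_integral_pushforward mN leb measurableT mF (fun x _ => F0 x)).
by apply: eq_measure_integral => A mA _; exact: lebesgue_measureN.
Qed.

(** The integrand is odd: reflection exchanges its positive and negative parts. *)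
Lemma Rintegral_sin_expNnorm y :
  \int[leb]_x (sin (y * x) * expNnorm x) = 0.
Proof.
have iF := integrable_sin_expNnorm y.
have mF : measurable_fun setT (EFin \o (fun x : RT => sin (y * x) * expNnorm x)).
  by case/integrableP : iF.
rewrite /Rintegral integralE -(ge0_integral_opp (measurable_funeneg mF)); last first.
  by move=> x; exact: funeneg_ge0.
set A := (X in (X - _)%E); set B := (X in (_ - X)%E).
have -> : B = A.
  apply: eq_integral => x _; rewrite funenegE funeposE/=.
  by rewrite mulrN sinN /expNnorm normrN mulNr opprK.
by rewrite subee// ; exact: (integrable_pos_fin_num measurableT iF).
Qed.

Lemma integral_cauchy_kernel : (\int[leb]_x (cauchy_kernel x)%:E = (2 * pi)%:E)%E.
Proof.
have k0 x : 0 <= cauchy_kernel x by rewrite ltW// cauchy_kernel_gt0.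
have ck : continuous cauchy_kernel.
  by move=> x; apply: cvgM; [exact: cvg_cst|exact: continuous_oneDsqrV].
have sym : cauchy_kernel =1 cauchy_kernel \o -%R.
  by move=> x /=; rewrite /cauchy_kernel /oneDsqr sqrrN.
rewrite (ge0_symfun_integralT k0 ck sym).
have -> : [set x : R | 0 <= x] = `[0, +oo[%classic.
  by apply/seteqP; split => x /=; rewrite in_itv/= andbT.
have m : measurable_fun setT (fun x : RT => (oneDsqr x)^-1).
  by apply: continuous_measurable_fun; exact: continuous_oneDsqrV.
under eq_integral do rewrite EFinM.
rewrite ge0_integralZl//; last first.
  by apply: measurable_funTS; exact/measurable_EFinP.
rewrite integral0y_oneDsqr -!EFinM; congr EFin; by field.
Qed.

Lemma integrable_cauchy_kernel : leb.-integrable setT (EFin \o cauchy_kernel).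
Proof.
apply/integrableP; split.
  apply/measurable_EFinP; apply: continuous_measurable_fun => x.
  by apply: cvgM; [exact: cvg_cst|exact: continuous_oneDsqrV].
under eq_integral => x _ do rewrite /= gtr0_norm ?cauchy_kernel_gt0//.
by rewrite integral_cauchy_kernel ltry.
Qed.

End laplace_kernel1.

Section product_rV.
Context {R : realType}.
Local Notation leb := (@lebesgue_measure R).
Local Notation RT := (measurableTypeR R).

Lemma cons_rV_head d (s : R) (x : 'rV[R]_d) : cons_rV (s, x) 0 0 = s.
Proof. by have /cons_rV_inj[] := cons_rV_split (cons_rV (s, x)). Qed.

Lemma cons_rV_tail d (s : R) (x : 'rV[R]_d) i : cons_rV (s, x) 0 (lift 0 i) = x 0 i.
Proof.
have /cons_rV_inj[_ H] := cons_rV_split (cons_rV (s, x)).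
by rewrite [in RHS]H mxE.
Qed.

Lemma dot_cons d (s t : R) (x y : 'rV[R]_d) :
  dot (cons_rV (s, x)) (cons_rV (t, y)) = s * t + dot x y.
Proof.
rewrite /dot [LHS]mxE [X in _ = _ + X]mxE big_ord_recl; congr (_ + _).
  by rewrite [X in _ * X]mxE !cons_rV_head.
apply: eq_bigr => i _; rewrite [X in _ * X = _]mxE !cons_rV_tail.
by rewrite [X in _ = _ * X]mxE.
Qed.

Lemma Rintegral_cons d (F : 'rV[R]_d.+1 -> R) :
  (lebesgue_rV R d.+1).-integrable setT (EFin \o F) ->
  \int[lebesgue_rV R d.+1]_x F x =
  \int[leb]_s \int[lebesgue_rV R d]_x F (cons_rV (s, x)).
Proof.
move=> iF; have iFp : (leb \x lebesgue_rV R d)%E.-integrable setT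
  (EFin \o (F \o @cons_rV R d)) by exact: integrable_cons iF.
rewrite {1}/Rintegral (integral_cons iF); congr fine; apply: ae_eq_integral => //.
- exact: measurable_fubini_F iFp.
- by apply/measurable_EFinP; exact: (measurable_marginal iFp).
by apply: filterS (EFin_marginal iFp) => s /= <-.
Qed.

Definition prod_rV (a : R -> R) d (x : 'rV[R]_d) : R := \prod_(i < d) a (x 0 i).

Lemma prod_rV_cons a d s (x : 'rV[R]_d) : prod_rV a (cons_rV (s, x)) = a s * prod_rV a x.
Proof.
rewrite /prod_rV big_ord_recl cons_rV_head; congr (_ * _).
by apply: eq_bigr => i _; rewrite cons_rV_tail.
Qed.

Lemma prod_rV_ge0 a d (x : 'rV[R]_d) : (forall s, 0 <= a s) -> 0 <= prod_rV a x.
Proof. by move=> a0; apply: prodr_ge0. Qed.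

Lemma measurable_prod_rV (a : R -> R) d : measurable_fun setT (a : RT -> R) ->
  measurable_fun setT (@prod_rV a d).
Proof.
move=> ma; rewrite /prod_rV; apply: measurable_prod => i _.
exact: (measurableT_comp ma (measurable_coord_rV i)).
Qed.

Lemma integral_prod_rV (a : R -> R) (A : R) d : measurable_fun setT (a : RT -> R) ->
  (forall s, 0 <= a s) -> (\int[leb]_s (a s)%:E = A%:E)%E ->
  (\int[lebesgue_rV R d]_x (prod_rV a x)%:E = (A ^+ d)%:E)%E.
Proof.
move=> ma a0 iA.
have mp n : measurable_fun setT (EFin \o @prod_rV a n).
  by apply/measurable_EFinP; exact: measurable_prod_rV.
elim: d => [|d IH].
  by rewrite integral_dirac// diracT mul1e /prod_rV big_ord0.
rewrite ge0_integral_cons; [|exact: mp|by move=> x; rewrite lee_fin prod_rV_ge0].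
transitivity (\int[leb]_s ((a s)%:E * (A ^+ d)%:E))%E.
  apply: eq_integral => s _.
  under eq_integral => x _ do rewrite prod_rV_cons EFinM.
  rewrite ge0_integralZl ?IH ?lee_fin//.
  by move=> x _; rewrite lee_fin prod_rV_ge0.
rewrite ge0_integralZr//; last first.
- by rewrite lee_fin exprn_ge0// -lee_fin -iA integral_ge0// => s _; rewrite lee_fin.
- by move=> s _; rewrite lee_fin.
- exact/measurable_EFinP.
by rewrite iA -EFinM exprS.
Qed.

Lemma integrable_prod_rV (a : R -> R) (A : R) d : measurable_fun setT (a : RT -> R) ->
  (forall s, 0 <= a s) -> (\int[leb]_s (a s)%:E = A%:E)%E ->
  (lebesgue_rV R d).-integrable setT (EFin \o @prod_rV a d).
Proof.
move=> ma a0 iA; apply/integrableP; split.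
  by apply/measurable_EFinP; exact: measurable_prod_rV.
under eq_integral => x _ do rewrite /= ger0_norm ?prod_rV_ge0//.
by rewrite (integral_prod_rV _ ma a0 iA) ltry.
Qed.

End product_rV.

Section kernel_rV.
Context {R : realType}.
Local Notation leb := (@lebesgue_measure R).
Local Notation RT := (measurableTypeR R).
Local Notation mu d := (lebesgue_rV R d).

Lemma measurable_expNnorm : measurable_fun setT (@expNnorm R : RT -> R).
Proof. by case/integrableP : (@integrable_expNnorm R) => /measurable_EFinP. Qed.

Lemma measurable_cauchy_kernel : measurable_fun setT (@cauchy_kernel R : RT -> R).
Proof. by case/integrableP : (@integrable_cauchy_kernel R) => /measurable_EFinP. Qed.

Definition expNrV d (k : 'rV[R]_d) : R := prod_rV (@expNnorm R) k.
Definition cauchyrV d (y : 'rV[R]_d) : R := prod_rV (@cauchy_kernel R) y.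

Lemma expNrV_ge0 d (k : 'rV[R]_d) : 0 <= expNrV k.
Proof. by apply: prod_rV_ge0 => s; exact: expNnorm_ge0. Qed.

Lemma cauchyrV_ge0 d (k : 'rV[R]_d) : 0 <= cauchyrV k.
Proof. by apply: prod_rV_ge0 => s; rewrite ltW// cauchy_kernel_gt0. Qed.

Lemma integrable_expNrV d : (mu d).-integrable setT (EFin \o @expNrV d).
Proof.
apply: integrable_prod_rV measurable_expNnorm (@expNnorm_ge0 R) _.
exact: integral_expNnorm.
Qed.

Lemma integral_cauchyrV d : (\int[mu d]_y (cauchyrV y)%:E = ((2 * pi) ^+ d)%:E)%E.
Proof.
apply: integral_prod_rV measurable_cauchy_kernel _ (@integral_cauchy_kernel R).
by move=> s; rewrite ltW// cauchy_kernel_gt0.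
Qed.

Lemma integrable_cauchyrV d : (mu d).-integrable setT (EFin \o @cauchyrV d).
Proof.
apply: integrable_prod_rV measurable_cauchy_kernel _ (@integral_cauchy_kernel R).
by move=> s; rewrite ltW// cauchy_kernel_gt0.
Qed.

(** By the addition formulas the transform of the product in dimension d + 1
splits into products of transforms in dimensions 1 and d.  The sine transform,
which vanishes, has to be carried along in the induction. *)
Lemma fourier_expNrV d (y : 'rV[R]_d) :
  fcos (@expNrV d) y = cauchyrV y /\ fsin (@expNrV d) y = 0.
Proof.
elim: d y => [|d IH] y.
  have dot0 (x : 'rV[R]_0) : dot y x = 0 by rewrite /dot mxE big_ord0.
  rewrite /fcos /fsin /Rintegral !integral_dirac//; last 2 first.
    by case/integrableP : (integrable_sin_mul y (integrable_expNrV 0)).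
    by case/integrableP : (integrable_cos_mul y (integrable_expNrV 0)).
  by rewrite !diracT !mul1e !dot0 cos0 sin0 mul0r mul1r /expNrV /cauchyrV /prod_rV !big_ord0.
have [t [{}y ->]] : exists t (y' : 'rV[R]_d), y = cons_rV (t, y').
  by rewrite (cons_rV_split y); eexists; eexists.
have iE := integrable_expNrV d.
have [Hc Hs] := IH y.
rewrite /fcos /fsin !Rintegral_cons; [|exact: integrable_sin_mul (integrable_expNrV _)
  |exact: integrable_cos_mul (integrable_expNrV _)].
split.
  transitivity (\int[leb]_s (cos (t * s) * expNnorm s * cauchyrV y)).
    apply: eq_Rintegral => s _.
    rewrite -Hc -[RHS]subr0 -(mulr0 (sin (t * s) * expNnorm s)) -Hs.
    rewrite -!RintegralZl//; [|exact: integrable_sin_mul|exact: integrable_cos_mul].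
    rewrite -RintegralB//; last 2 first.
      exact: (integrableZl measurableT _ (integrable_cos_mul y iE)).
      exact: (integrableZl measurableT _ (integrable_sin_mul y iE)).
    apply: eq_Rintegral => x _.
    by rewrite dot_cons /expNrV prod_rV_cons cosD; ring.
  rewrite RintegralZr//; last exact: integrable_cos_expNnorm.
  by rewrite Rintegral_cos_expNnorm /cauchyrV prod_rV_cons.
transitivity (\int[leb]_s (sin (t * s) * expNnorm s * cauchyrV y)).
  apply: eq_Rintegral => s _.
  rewrite -Hc -[RHS]addr0 -(mulr0 (cos (t * s) * expNnorm s)) -Hs.
  rewrite -!RintegralZl//; [|exact: integrable_sin_mul|exact: integrable_cos_mul].
  rewrite -RintegralD//; last 2 first.
    exact: (integrableZl measurableT _ (integrable_cos_mul y iE)).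
    exact: (integrableZl measurableT _ (integrable_sin_mul y iE)).
  apply: eq_Rintegral => x _.
  by rewrite dot_cons /expNrV prod_rV_cons sinD; ring.
rewrite RintegralZr//; last exact: integrable_sin_expNnorm.
by rewrite Rintegral_sin_expNnorm mul0r.
Qed.

End kernel_rV.

(** * Mollification and lower semicontinuity of the norm *)
Section mollifier.
Context {R : realType} {d : nat}.
Local Notation mu := (lebesgue_rV R d).
Implicit Types (g : 'rV[R]_d -> R) (k x y : 'rV[R]_d).

Lemma dotC k x : dot k x = dot x k.
Proof. by rewrite /dot !mxE; apply: eq_bigr => i _; rewrite !mxE mulrC. Qed.

Definition mollify (e : R) g : 'rV[R]_d -> R :=
  shift_mean mu (@cauchyrV R d) (fun y => e *: y) g.

Let measurable_scale (e : R) : measurable_fun setT (fun y : 'rV[R]_d => e *: y).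
Proof. by apply: measurable_scalerV => //; exact: measurable_cst. Qed.

(** The total mass of the kernel [cauchyrV]. *)
Let C : R := (2 * pi) ^+ d.

Let C_gt0 : 0 < C.
Proof. by rewrite exprn_gt0// mulr_gt0// pi_gt0. Qed.

Let integral_normr_cauchyrV : (\int[mu]_y `|cauchyrV y|%:E = C%:E)%E.
Proof.
rewrite -integral_cauchyrV; apply: eq_integral => y _.
by rewrite ger0_norm// cauchyrV_ge0.
Qed.

Lemma integrable_mollify (e : R) g : mu.-integrable setT (EFin \o g) ->
  mu.-integrable setT (EFin \o mollify e g).
Proof. by move=> ig; apply: integrable_shift_mean => //; exact: integrable_cauchyrV. Qed.

Lemma l1norm_mollify_le (e : R) g : mu.-integrable setT (EFin \o g) ->
  (l1norm (mollify e g) <= C%:E * l1norm g)%E.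
Proof.
move=> ig; rewrite -integral_normr_cauchyrV.
by apply: l1norm_shift_mean_le => //; exact: integrable_cauchyrV.
Qed.

Section inversion.
Variables (e : R) (e0 : 0 < e) (x : 'rV[R]_d).

(** The inner integral that remains once the kernel is replaced by its Fourier
integral and the integrations are exchanged; see [mollify_inversion]. *)
Definition windowed_fourier g k : R := \int[mu]_y (cos (dot k y) * g (x + e *: y)).

(** The substitution z = x + e y expresses it through the transform of g at k / e. *)
Lemma windowed_fourierE g k : mu.-integrable setT (EFin \o g) ->
  windowed_fourier g k = (e ^+ d)^-1 *
    (cos (dot (e^-1 *: k) x) * fcos g (e^-1 *: k) +
     sin (dot (e^-1 *: k) x) * fsin g (e^-1 *: k)).
Proof.
move=> ig; set k' := e^-1 *: k.
have i1 := integrable_cos_mul k' ig; have i2 := integrable_sin_mul k' ig.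
have i1' : mu.-integrable setT (EFin \o (fun z => cos (dot k' x) * (cos (dot k' z) * g z))).
  exact: (integrableZl measurableT _ i1).
have i2' : mu.-integrable setT (EFin \o (fun z => sin (dot k' x) * (sin (dot k' z) * g z))).
  exact: (integrableZl measurableT _ i2).
pose F z := cos (dot k' x) * (cos (dot k' z) * g z) + sin (dot k' x) * (sin (dot k' z) * g z).
have iF : mu.-integrable setT (EFin \o F) by exact: (integrableD measurableT i1' i2').
rewrite /fcos /fsin -!RintegralZl// -RintegralD// -[RHS](Rintegral_affine x e0 iF).
apply: eq_Rintegral => y _; rewrite /F !mulrA -mulrDl; congr (_ * _).
have -> : dot k y = dot k' (x + e *: y) - dot k' x.
  by rewrite dotDr addrC addKr /k' dotZl dotZr mulrA mulVf ?mul1r// gt_eqF.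
by rewrite cosB; ring.
Qed.

Let window g (p : 'rV[R]_d * 'rV[R]_d) : R :=
  expNrV p.1 * (cos (dot p.1 p.2) * g (x + e *: p.2)).

Let integrable_window g : mu.-integrable setT (EFin \o g) ->
  (mu \x mu)%E.-integrable setT (EFin \o window g).
Proof.
move=> ig; have ige := integrable_affine x e0 ig.
have m0 : measurable_fun setT (fun _ : 'rV[R]_d => 0 : 'rV[R]_d) by exact: measurable_cst.
have i0 := integrable_shift_mean_integrand ige m0 (@integrable_expNrV R d).
have mcos : measurable_fun setT (fun p : 'rV[R]_d * 'rV[R]_d => cos (dot p.1 p.2)).
  apply: (measurableT_comp (continuous_measurable_fun (@continuous_cos R))).
  by apply: measurable_dotrV; [exact: measurable_fst|exact: measurable_snd].
have := integrable_bounded_mul mcos (fun p => normr_cos_le1 _) i0.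
by apply: eq_integrable => // p _ /=; rewrite /window addr0; congr EFin; ring.
Qed.

Let marginal_window g k : mu.-integrable setT (EFin \o g) ->
  marginal mu (window g) k = expNrV k * windowed_fourier g k.
Proof.
move=> ig; rewrite /marginal /window/= RintegralZl//.
exact: integrable_cos_mul (integrable_affine x e0 ig).
Qed.

(** Fubini's theorem, the kernel being itself a Fourier integral: the
mollification of g at a point only depends on the transform of g. *)
Lemma mollify_inversion g : mu.-integrable setT (EFin \o g) ->
  mollify e g x = \int[mu]_k (expNrV k * windowed_fourier g k).
Proof.
move=> ig; have m1 : measurable_fun setT (fun _ : 'rV[R]_d => 1 : R) by exact: measurable_cst.
transitivity (\int[mu]_k (1 * marginal mu (window g) k)); last first.
  by apply: eq_Rintegral => k _; rewrite mul1r marginal_window.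
rewrite (Rintegral_marginal m1 _ (integrable_window ig)); last by move=> k; rewrite normr1.
apply: eq_Rintegral => y _.
have [<- _] := fourier_expNrV y.
rewrite -RintegralZr//; last exact: integrable_cos_mul (@integrable_expNrV R d).
by apply: eq_Rintegral => k _; rewrite mul1r /window/= (dotC y k); ring.
Qed.

(** Dominated convergence in the inversion formula; the common bound M on the
norms bounds all the transforms. *)
Lemma cvg_mollify (gn : nat -> 'rV[R]_d -> R) g (M : R) :
  (forall n, mu.-integrable setT (EFin \o gn n)) -> mu.-integrable setT (EFin \o g) ->
  (forall n, l1norm (gn n) <= M%:E)%E ->
  (forall k, fcos (gn n) k @[n --> \oo] --> fcos g k) ->
  (forall k, fsin (gn n) k @[n --> \oo] --> fsin g k) ->
  mollify e (gn n) x @[n --> \oo] --> mollify e g x.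
Proof.
move=> ign ig gM cc cs.
have mw h : mu.-integrable setT (EFin \o h) ->
    measurable_fun setT (EFin \o (fun k => expNrV k * windowed_fourier h k)).
  move=> ih; apply/measurable_EFinP.
  rewrite (_ : (fun k => _) = marginal mu (window h)).
    exact: measurable_marginal (integrable_window ih).
  by apply/funext => k; rewrite marginal_window.
have ei : 0 <= (e ^+ d)^-1 by rewrite invr_ge0 exprn_ge0// ltW.
have := @dominated_convergence _ _ _ mu setT measurableT
  (fun n k => (expNrV k * windowed_fourier (gn n) k)%:E)
  (fun k => (expNrV k * windowed_fourier g k)%:E)
  (fun k => (((e ^+ d)^-1 * (2 * M))%:E * (expNrV k)%:E)%E).
case.
- by move=> n; exact: mw.
- exact: mw.
- apply: aeW => k _; apply: cvg_EFin; first exact: nearW.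
  apply: cvgM; first exact: cvg_cst.
  rewrite windowed_fourierE//; under eq_fun do rewrite windowed_fourierE//.
  apply: cvgM; first exact: cvg_cst.
  by apply: cvgD; apply: cvgM => //; exact: cvg_cst.
- by apply: integrableZl => //; exact: integrable_expNrV.
- apply: aeW => k n _; rewrite /= -EFinM lee_fin normrM ger0_norm ?expNrV_ge0// mulrC.
  rewrite ler_wpM2r ?expNrV_ge0// windowed_fourierE// normrM (ger0_norm ei).
  rewrite ler_wpM2l// (le_trans (ler_normD _ _))// mulr_natl mulr2n.
  have fM : `|fcos (gn n) (e^-1 *: k)| <= M.
    by rewrite -lee_fin; exact: le_trans (fcos_norm_le _ (ign n)) (gM n).
  have sM : `|fsin (gn n) (e^-1 *: k)| <= M.
    by rewrite -lee_fin; exact: le_trans (fsin_norm_le _ (ign n)) (gM n).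
  rewrite lerD// normrM; [apply: le_trans fM|apply: le_trans sM].
    by rewrite ler_piMl// normr_cos_le1.
  by rewrite ler_piMl// normr_sin_le1.
move=> ilim _ cint; rewrite mollify_inversion//; under eq_fun do rewrite mollify_inversion//.
by apply: fine_cvg; rewrite fineK//; exact: integrable_fin_num.
Qed.

End inversion.

(** The difference is an average of moduli of g at e w, weighted by the kernel;
these tend to 0 with e and are at most twice the norm of g. *)
Lemma l1norm_mollifyB_cvg g : mu.-integrable setT (EFin \o g) ->
  (l1norm (fun x => mollify n.+1%:R^-1 g x - C * g x)%R)%E @[n --> \oo] --> 0%E.
Proof.
move=> ig; have mg := l1norm_measurable ig.
have m0 : measurable_fun setT (fun _ : 'rV[R]_d => 0 : 'rV[R]_d) by exact: measurable_cst.
have meanE x : shift_mean mu (@cauchyrV R d) (fun=> 0) g x = C * g x.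
  rewrite /shift_mean addr0 RintegralZr//; last exact: integrable_cauchyrV.
  by rewrite /Rintegral integral_cauchyrV.
have mD (e : R) : measurable_fun setT (fun w : 'rV[R]_d => `|cauchyrV w|%:E * l1modulus g (e *: w - 0)%R)%E.
  apply: emeasurable_funM.
    apply/measurable_EFinP; apply: measurableT_comp => //.
    by case/integrableP : (@integrable_cauchyrV R d) => /measurable_EFinP.
  apply: (measurable_fun_fubini_tonelli_F (m2 := mu)
    (fun p : 'rV[R]_d * 'rV[R]_d => `|g (p.2 + (e *: p.1 - 0)) - g p.2|%:E)) => //.
    apply: measurable_normB.
      apply: (measurableT_comp mg); apply: measurable_addrV; first exact: measurable_snd.
      under eq_fun do rewrite subr0.
      by apply: measurable_scalerV; [exact: measurable_cst|exact: measurable_fst].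
    exact: (measurableT_comp mg measurable_snd).
apply: (@ge0_cvge0_le R nat _ _ _ (fun n => \int[mu]_w
    (`|cauchyrV w|%:E * l1modulus g (n.+1%:R^-1 *: w - 0)%R))%E (cst 0%E)).
- by move=> n; exact: l1norm_ge0.
- move=> n; rewrite adde0; under eq_fun do rewrite -meanE.
  apply: l1norm_shift_meanB_le => //; exact: integrable_cauchyrV.
- have := @dominated_convergence _ _ _ mu setT measurableT
    (fun n w => `|cauchyrV w|%:E * l1modulus g (n.+1%:R^-1 *: w - 0)%R)%E (cst 0%E)
    (fun w => `|cauchyrV w|%:E * (2%:E * l1norm g))%E.
  case.
  + by move=> n; exact: mD.
  + exact: measurable_cst.
  + apply: aeW => w _.
    rewrite -(mule0 `|cauchyrV w|%:E); apply: cvgeZl => //.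
    apply: translation_cvg => // i.
    under eq_fun do rewrite subr0 mxE.
    rewrite -(mul0r (w 0 i)); apply: cvgM; last exact: cvg_cst.
    exact: cvg_harmonic.
  + have fn : (2%:E * l1norm g)%E \is a fin_num by rewrite fin_numM// l1norm_fin.
    rewrite -(fineK fn); apply: integrableZr => //.
    exact: (integrable_norm (@integrable_cauchyrV R d)).
  + apply: aeW => w n _; rewrite gee0_abs ?mule_ge0 ?l1modulus_ge0 ?lee_fin//.
    by rewrite lee_wpmul2l ?lee_fin// l1modulus_le.
  move=> _ _; rewrite integral0; apply: cvg_trans; apply: near_eq_cvg; apply: nearW => n //.
- exact: cvg_cst.
Qed.

(** At scale e, the mollifications of the gn n have norm at most C M and converge
pointwise to that of g, which has norm at most C M by Fatou's lemma; as e tends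
to 0 this norm tends to C times the norm of g. *)
Theorem l1norm_le_of_fourier_cvg (gn : nat -> 'rV[R]_d -> R) g (M : R) :
  (forall n, mu.-integrable setT (EFin \o gn n)) -> mu.-integrable setT (EFin \o g) ->
  (forall n, l1norm (gn n) <= M%:E)%E ->
  (forall k, fcos (gn n) k @[n --> \oo] --> fcos g k) ->
  (forall k, fsin (gn n) k @[n --> \oo] --> fsin g k) ->
  (l1norm g <= M%:E)%E.
Proof.
move=> ign ig gM cc cs; have mg := l1norm_measurable ig.
have mM (e : R) h : mu.-integrable setT (EFin \o h) -> measurable_fun setT (mollify e h).
  by move=> ih; exact: l1norm_measurable (integrable_mollify e ih).
have mnM (e : R) h : mu.-integrable setT (EFin \o h) ->
    measurable_fun setT (fun x => `|mollify e h x|%:E).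
  by move=> ih; apply/measurable_EFinP; apply: measurableT_comp => //; exact: mM.
have mollM (e : R) : 0 < e -> (l1norm (mollify e g) <= (C * M)%:E)%E.
  move=> e0.
  have := @fatou _ _ _ mu setT measurableT (fun n x => `|mollify e (gn n) x|%:E)
    (fun n => mnM e _ (ign n)) (fun n x _ => normr_ge0 _).
  have -> : (\int[mu]_x limn_einf (fun n => `|mollify e (gn n) x|%:E) = l1norm (mollify e g))%E.
    apply: eq_integral => x _.
    have cx : `|mollify e (gn n) x|%:E @[n --> \oo] --> `|mollify e g x|%:E.
      apply: cvg_EFin; first exact: nearW.
      by apply: cvg_norm; exact: (@cvg_mollify e e0 x gn g M).
    by rewrite (cvg_limn_einf_sup cx).1.
  move=> /le_trans; apply; rewrite limn_einf_lim.
  apply: lime_le; first exact: is_cvg_einfs.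
  apply: nearW => n; apply: le_trans (ereal_inf_lbound _) _; first by exists n => /=.
  apply: le_trans (l1norm_mollify_le e (ign n)) _.
  by rewrite EFinM lee_wpmul2l ?lee_fin// ltW.
have mB (e : R) : measurable_fun setT (fun x => mollify e g x - C * g x).
  by apply: measurable_funB; [exact: mM|exact: measurable_funM].
have key : (C%:E * l1norm g <= C%:E * M%:E)%E.
  have -> : (C%:E * l1norm g = l1norm (fun x => C * g x)%R)%E.
    rewrite /l1norm -ge0_integralZl//; last 2 first.
      by apply/measurable_EFinP; exact: measurableT_comp.
      by rewrite lee_fin ltW.
    by apply: eq_integral => x _; rewrite normrM gtr0_norm// EFinM.
  apply/lee_addgt0Pr => e e0.
  have [n nP] := cvge0_exists (fun n => l1norm_ge0 _) (l1norm_mollifyB_cvg ig) e0.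
  have n0 : 0 < n.+1%:R^-1 :> R by rewrite invr_gt0 ltr0n.
  rewrite -EFinM; apply: le_trans (leeD (mollM _ n0) nP).
  apply: l1norm_add_le; [exact: measurable_funM|exact: mM|exact: mB|].
  move=> x; have := ler_normB (mollify n.+1%:R^-1 g x) (mollify n.+1%:R^-1 g x - C * g x).
  by rewrite opprB addrC subrK.
by move: key; rewrite lee_pmul2l// lte_fin.
Qed.

End mollifier.

(** * Exponential orbits in the complex plane *)
Section exponential_orbit.
Context {R : realType}.
Implicit Types (z c : R[i]) (q : R).

(** The real part of the solution at time q of w' = z w with w(0) = c.  The
imaginary part is the opposite of the orbit of i c, and the derivative is the
orbit of z c, so this one real function suffices. *)
Definition orbit_re z c q : R := complex.Re (cexp (q%:C * z) * c).

Lemma orbit_reE (a b A B q : R) : orbit_re (a +i* b) (A +i* B) q =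
  expR (q * a) * (A * cos (q * b) - B * sin (q * b)).
Proof. by rewrite /orbit_re /cexp; simpc => /=; ring. Qed.

Lemma is_derive_orbit_re z c q : is_derive q (1 : R) (orbit_re z c) (orbit_re z (z * c) q).
Proof.
case: z c => a b [A B].
have -> : orbit_re (a +i* b) (A +i* B) =
    fun q => expR (q * a) * (A * cos (q * b) - B * sin (q * b)).
  by apply/funext => p; exact: orbit_reE.
simpc; rewrite orbit_reE; apply: is_derive_eq.
have sc (x y : R) : x *: (y : R^o) = x * y by [].
by rewrite !sc; ring.
Qed.

Lemma orbit_re_bound (K : R) z c : exists M, forall q, `|q| <= K -> `|orbit_re z c q| <= M.
Proof.
case: z c => a b [A B]; exists (expR (K * `|a|) * (`|A| + `|B|)) => q qK.
rewrite orbit_reE normrM ger0_norm ?expR_ge0//; apply: ler_pM => //.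
  by rewrite ler_expR (le_trans (ler_norm _))// normrM ler_wpM2r.
rewrite (le_trans (ler_normB _ _))// lerD// normrM ler_piMr//.
  by rewrite ler_norml cos_geN1 cos_le1.
by rewrite ler_norml sin_geN1 sin_le1.
Qed.

End exponential_orbit.

Section calculus.
Context {R : realType}.

Lemma derive_eq0_const (D : R -> R) (u t : R) : u < t ->
  (forall x, u <= x <= t -> is_derive x (1 : R) D 0) -> D u = D t.
Proof.
move=> ut dD.
have [||c _] := @MVT R D (fun=> 0) u t ut.
- by move=> x; rewrite in_itv/= => /andP[/ltW ux /ltW xt]; apply: dD; rewrite ux.
- apply: derivable_within_continuous => x; rewrite in_itv/= => xut.
  by case: (dD x xut).
by rewrite mul0r => /eqP; rewrite subr_eq0 => /eqP ->.
Qed.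

Lemma MVT_unordered (F F1 : R -> R) (x y : R) :
  (forall x, is_derive x (1 : R) F (F1 x)) ->
  exists2 c, F y - F x = F1 c * (y - x) & (x <= c <= y) || (y <= c <= x).
Proof.
move=> dF.
have H (u w : R) : u <= w -> exists2 c, F w - F u = F1 c * (w - u) & u <= c <= w.
  move=> uw; have [|c cuw Fc] := @MVT_segment R F F1 u w uw (fun t _ => dF t).
    by apply: derivable_within_continuous => t _; case: (dF t).
  by exists c.
have [/H[c Fc cxy]|/ltW/H[c Fc cyx]] := leP x y; first by exists c; rewrite ?cxy.
exists c; last by rewrite cyx orbT.
by rewrite -opprB Fc -mulrN opprB.
Qed.

(** Two applications of the mean value theorem, in either order of p and q. *)
Lemma taylor1_le (G G1 G2 : R -> R) (K M p q : R) :
  (forall x, is_derive x (1 : R) G (G1 x)) ->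
  (forall x, is_derive x (1 : R) G1 (G2 x)) ->
  (forall x, `|x| <= K -> `|G2 x| <= M) -> `|p| <= K -> `|q| <= K ->
  `|G q - G p - (q - p) * G1 p| <= M * (q - p) ^+ 2.
Proof.
move=> dG dG1 GM pK qK.
have btw (x y c L : R) : (x <= c <= y) || (y <= c <= x) -> `|x| <= L -> `|y| <= L -> `|c| <= L.
  by rewrite !ler_norml => /orP[] /andP[? ?] /andP[? ?] /andP[? ?]; apply/andP; split; lra.
have btwB (x y c : R) : (x <= c <= y) || (y <= c <= x) -> `|c - x| <= `|y - x|.
  move=> /orP[] /andP[h1 h2].
    by rewrite !ger0_norm ?subr_ge0 ?(le_trans h1)// lerD2r.
  by rewrite !ler0_norm ?subr_le0 ?(le_trans h1)// lerN2 lerD2r.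
have [c -> cpq] := MVT_unordered p q dG.
rewrite [(q - p) * _]mulrC -mulrBl.
have cK := btw _ _ _ _ cpq pK qK.
have [c' -> c'p] := MVT_unordered p c dG1.
have c'K := btw _ _ _ _ c'p pK cK.
rewrite !normrM -[X in _ <= _ * X]real_normK ?num_real// expr2 mulrA.
by rewrite ler_wpM2r// ler_pM ?GM// btwB.
Qed.

(** Telescoping G q - G p over the subdivision, each of the n + 1 increments
differs from the corresponding term by a second-order error, hence the total
error is of order 1 / (n + 1). *)
Lemma riemann_sum_cvg (G G1 G2 : R -> R) (M p q : R) :
  (forall x, is_derive x (1 : R) G (G1 x)) ->
  (forall x, is_derive x (1 : R) G1 (G2 x)) ->
  (forall x, `|x| <= `|p| + `|q - p| -> `|G2 x| <= M) ->
  \sum_(i < n.+1) ((q - p) / n.+1%:R * G1 (p + (q - p) / n.+1%:R * i%:R))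
    @[n --> \oo] --> G q - G p.
Proof.
move=> dG dG1 GM; set L := `|p| + _ in GM.
pose x n (i : nat) := p + (q - p) / n.+1%:R * i%:R : R.
have xL n (i : nat) : (i <= n.+1)%N -> `|x n i| <= L.
  move=> iN; rewrite /x /L (le_trans (ler_normD _ _))// lerD2l -mulrA normrM ler_piMr//.
  by rewrite ger0_norm ?divr_ge0// mulrC ler_pdivrMr// mul1r ler_nat.
have step n i : x n i.+1 - x n i = (q - p) / n.+1%:R.
  by rewrite /x -natr1; ring.
have bound n : `|\sum_(i < n.+1) ((q - p) / n.+1%:R * G1 (x n i)) - (G q - G p)| <=
    M * (q - p) ^+ 2 * n.+1%:R^-1.
  have -> : G q - G p = \sum_(i < n.+1) (G (x n i.+1) - G (x n i)).
    rewrite -(big_mkord xpredT (fun i => G (x n i.+1) - G (x n i))).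
    rewrite (telescope_sumr (fun i => G (x n i)))// /x mulr0 addr0 -mulrA mulVf ?mulr1.
      by rewrite (addrC p) subrK.
    by rewrite pnatr_eq0.
  rewrite -sumrB (le_trans (ler_norm_sum _ _ _))//.
  apply: (@le_trans _ _ (\sum_(i < n.+1) M * ((q - p) / n.+1%:R) ^+ 2)).
    apply: ler_sum => i _; rewrite -(step n i) distrC.
    by apply: taylor1_le dG dG1 GM _ _; apply: xL; [exact: ltnW (ltn_ord i)|exact: ltn_ord i].
  rewrite sumr_const card_ord -[X in X <= _]mulr_natr expr_div_n.
  rewrite le_eqVlt; apply/orP; left; apply/eqP.
  have : n.+1%:R != 0 :> R by rewrite pnatr_eq0.
  by move: n.+1%:R => N N0; field.
apply/subr_cvg0/norm_cvg0P.
apply: (@squeeze_cvgr _ _ _ _ (cst 0) (fun n => M * (q - p) ^+ 2 * n.+1%:R^-1)).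
- by apply: nearW => n; rewrite normr_ge0/= bound.
- exact: cvg_cst.
- by rewrite -(mulr0 (M * (q - p) ^+ 2)); apply: cvgM; [exact: cvg_cst|exact: cvg_harmonic].
Qed.

Lemma orbit_re_riemann (z c : R[i]) (p q : R) :
  \sum_(i < n.+1) ((q - p) / n.+1%:R * orbit_re z (z * c) (p + (q - p) / n.+1%:R * i%:R))
    @[n --> \oo] --> orbit_re z c q - orbit_re z c p.
Proof.
have [M HM] := orbit_re_bound (`|p| + `|q - p|) z (z * (z * c)).
by apply: riemann_sum_cvg HM => x; exact: is_derive_orbit_re.
Qed.

Lemma constant_of_derive0 (D : R -> R) (t : R) : 0 <= t ->
  (forall x : R, 0 < x -> is_derive x (1 : R) D 0) -> D x @[x --> 0^'+] --> D 0 -> D t = D 0.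
Proof.
rewrite le_eqVlt => /predU1P[<-//|t0] dD cD.
have cDt : D x @[x --> 0^'+] --> D t.
  apply: (@cvg_trans _ ((fun=> D t) x @[x --> 0^'+])); last exact: cvg_cst.
  apply: near_eq_cvg; near=> x.
  have x0 : 0 < x by [].
  have xt : x < t by near: x; exact: nbhs_right_lt.
  by apply/esym/(derive_eq0_const xt) => y /andP[xy _]; apply: dD; exact: lt_le_trans xy.
exact: cvg_unique cDt cD.
Unshelve. all: by end_near. Qed.

(** The derivative of exp(- s z) (A + i B) vanishes, where z = a + i b, so this
product keeps its initial value. *)
Lemma orbit_unique (a b : R) (s sg A B : R -> R) (t : R) : 0 <= t -> s 0 = 0 ->
  (forall x : R, 0 < x -> is_derive x (1 : R) s (sg x)) ->
  (forall x : R, 0 < x -> is_derive x (1 : R) A (sg x * (a * A x - b * B x))) ->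
  (forall x : R, 0 < x -> is_derive x (1 : R) B (sg x * (a * B x + b * A x))) ->
  s x @[x --> 0^'+] --> s 0 -> A x @[x --> 0^'+] --> A 0 -> B x @[x --> 0^'+] --> B 0 ->
  A t +i* B t = cexp ((s t)%:C * (a +i* b)) * (A 0 +i* B 0).
Proof.
move=> t0 s0 ds dA dB cs cA cB.
(* the real and imaginary parts of exp(- s z) (A + i B) *)
pose D1 x := expR (- (s x * a)) * (A x * cos (s x * b) + B x * sin (s x * b)).
pose D2 x := expR (- (s x * a)) * (B x * cos (s x * b) - A x * sin (s x * b)).
have sc (x y : R) : x *: (y : R^o) = x * y by [].
have csa : s x * a @[x --> 0^'+] --> s 0 * a by apply: cvgM => //; exact: cvg_cst.
have csb : s x * b @[x --> 0^'+] --> s 0 * b by apply: cvgM => //; exact: cvg_cst.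
have cE : expR (- (s x * a)) @[x --> 0^'+] --> expR (- (s 0 * a)).
  by apply: continuous_cvg; [exact: continuous_expR|exact: cvgN].
have cC : cos (s x * b) @[x --> 0^'+] --> cos (s 0 * b).
  by apply: continuous_cvg; [exact: continuous_cos|].
have cS : sin (s x * b) @[x --> 0^'+] --> sin (s 0 * b).
  by apply: continuous_cvg; [exact: continuous_sin|].
have E1 : D1 t = D1 0.
  apply: constant_of_derive0 => // [x x0|].
    have := ds x x0; have := dA x x0; have := dB x x0 => ? ? ?.
    by apply: is_derive_eq; rewrite !sc; ring.
  by apply: cvgM => //; apply: cvgD; apply: cvgM.
have E2 : D2 t = D2 0.
  apply: constant_of_derive0 => // [x x0|].
    have := ds x x0; have := dA x x0; have := dB x x0 => ? ? ?.
    by apply: is_derive_eq; rewrite !sc; ring.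
  by apply: cvgM => //; apply: cvgB; apply: cvgM.
move: E1 E2; rewrite /D1 /D2 s0 !mul0r oppr0 expR0 cos0 sin0 !mulr1 !mulr0 !mul1r addr0 subr0.
move=> <- <-; rewrite /cexp; simpc => /=.
have EN : expR (s t * a) * expR (- (s t * a)) = 1 by rewrite -expRD subrr expR0.
have CS : cos (s t * b) ^+ 2 + sin (s t * b) ^+ 2 = 1 by exact: cos2Dsin2.
congr (_ +i* _).
  rewrite -[LHS]mul1r -EN -[LHS]mul1r -CS; ring.
rewrite -[LHS]mul1r -EN -[LHS]mul1r -CS; ring.
Qed.

End calculus.

(** * Uniqueness of Fourier transforms *)
Section fourier_orbit.
Context {R : realType} {d : nat}.
Local Notation mu := (lebesgue_rV R d).
Implicit Types (g h : 'rV[R]_d -> R) (k : 'rV[R]_d).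

(** These two lemmas present both real transforms as real parts of multiples of
the complex one, so that an identity between complex transforms serves both. *)
Lemma fcosE g k : mu.-integrable setT (EFin \o g) -> fcos g k = complex.Re (fourier g k).
Proof. by move=> ig; rewrite fourierE. Qed.

Lemma fsinE g k : mu.-integrable setT (EFin \o g) -> fsin g k = complex.Re ((0 +i* 1) * fourier g k).
Proof. by move=> ig; rewrite fourierE//= mul0r mul1r sub0r opprK. Qed.

Lemma integrable_sum_l1 (n : nat) (F : 'I_n -> 'rV[R]_d -> R) :
  (forall i, mu.-integrable setT (EFin \o F i)) ->
  mu.-integrable setT (EFin \o (fun x => \sum_(i < n) F i x)).
Proof.
elim: n F => [|n IH] F iF.
  under eq_fun do rewrite big_ord0; exact: integrable0.
under eq_fun do rewrite big_ord_recl.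
exact: (integrableD measurableT (iF ord0) (IH _ (fun i => iF (lift ord0 i)))).
Qed.

Lemma l1norm_sum_le (n : nat) (F : 'I_n -> 'rV[R]_d -> R) (M : R) :
  (forall i, mu.-integrable setT (EFin \o F i)) ->
  (forall i, l1norm (F i) <= M%:E)%E ->
  (l1norm (fun x => \sum_(i < n) F i x)%R <= (M *+ n)%:E)%E.
Proof.
elim: n F => [|n IH] F iF FM.
  rewrite /l1norm integral0_eq// => x _.
  by rewrite big_ord0 normr0.
rewrite mulrS EFinD; 
have H := leeD (FM ord0) (IH _ (fun i => iF (lift ord0 i)) (fun i => FM (lift ord0 i))).
apply: le_trans H.
apply: l1norm_add_le.
- exact: l1norm_measurable (integrable_sum_l1 iF).
- exact: l1norm_measurable (iF ord0).
- exact: l1norm_measurable (integrable_sum_l1 (fun i => iF (lift ord0 i))).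
- by move=> x; rewrite big_ord_recl ler_normD.
Qed.

Lemma fcos_sum (n : nat) (F : 'I_n -> 'rV[R]_d -> R) k :
  (forall i, mu.-integrable setT (EFin \o F i)) ->
  fcos (fun x => \sum_(i < n) F i x) k = \sum_(i < n) fcos (F i) k.
Proof.
elim: n F => [|n IH] F iF.
  rewrite big_ord0 /fcos; under eq_Rintegral do rewrite big_ord0 mulr0.
  by rewrite /Rintegral integral0.
rewrite big_ord_recl -IH// -fcosD//; last by apply: integrable_sum_l1.
by congr fcos; apply/funext => x; rewrite big_ord_recl.
Qed.

Lemma fsin_sum (n : nat) (F : 'I_n -> 'rV[R]_d -> R) k :
  (forall i, mu.-integrable setT (EFin \o F i)) ->
  fsin (fun x => \sum_(i < n) F i x) k = \sum_(i < n) fsin (F i) k.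
Proof.
elim: n F => [|n IH] F iF.
  rewrite big_ord0 /fsin; under eq_Rintegral do rewrite big_ord0 mulr0.
  by rewrite /Rintegral integral0.
rewrite big_ord_recl -IH// -fsinD//; last by apply: integrable_sum_l1.
by congr fsin; apply/funext => x; rewrite big_ord_recl.
Qed.

Lemma l1normZ (c : R) g : measurable_fun setT g ->
  (l1norm (fun x => c * g x)%R = `|c|%:E * l1norm g)%E.
Proof.
move=> mg; rewrite /l1norm -ge0_integralZl//; last first.
  by apply/measurable_EFinP; exact: measurableT_comp.
by apply: eq_integral => x _; rewrite normrM EFinM.
Qed.

Lemma ae_eq_of_l1norm0 g h : measurable_fun setT g -> measurable_fun setT h ->
  (l1norm (fun x => g x - h x)%R <= 0)%E -> g = h %[ae mu].
Proof.
move=> mg mh gh0.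
have mB : measurable_fun setT (EFin \o (fun x => g x - h x)).
  by apply/measurable_EFinP; exact: measurable_funB.
have : ae_eq mu setT (EFin \o (fun x => g x - h x)) (cst 0%E).
  apply/(ae_eq_integral_abs mu measurableT mB)/eqP.
  by rewrite eq_le gh0 l1norm_ge0.
by apply: filterS => x /(_ I)[] /eqP; rewrite subr_eq0 => /eqP.
Qed.

Lemma fcos_ae g h k : measurable_fun setT g -> measurable_fun setT h ->
  g = h %[ae mu] -> fcos g k = fcos h k.
Proof.
move=> mg mh gh; congr fine; apply: ae_eq_integral => //.
- by apply/measurable_EFinP; apply: measurable_funM => //; exact: measurable_cos_dot.
- by apply/measurable_EFinP; apply: measurable_funM => //; exact: measurable_cos_dot.
- by apply: filterS gh => x -> .
Qed.

Lemma fsin_ae g h k : measurable_fun setT g -> measurable_fun setT h ->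
  g = h %[ae mu] -> fsin g k = fsin h k.
Proof.
move=> mg mh gh; congr fine; apply: ae_eq_integral => //.
- by apply/measurable_EFinP; apply: measurable_funM => //; exact: measurable_sin_dot.
- by apply/measurable_EFinP; apply: measurable_funM => //; exact: measurable_sin_dot.
- by apply: filterS gh => x -> .
Qed.

(** The constant sequence 0 approximates the transform of g - h with bound 0 in
[l1norm_le_of_fourier_cvg]. *)
Lemma fourier_inj_ae g h : mu.-integrable setT (EFin \o g) -> mu.-integrable setT (EFin \o h) ->
  (forall k, fourier g k = fourier h k) -> g = h %[ae mu].
Proof.
move=> ig ih gh.
have iB : mu.-integrable setT (EFin \o (fun x => g x - h x)) by exact: (integrableB measurableT ig ih).
apply: ae_eq_of_l1norm0; [exact: l1norm_measurable|exact: l1norm_measurable|].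
have f0 k : fcos (fun _ : 'rV[R]_d => 0 : R) k = 0.
  by rewrite /fcos /Rintegral integral0_eq// => x _; rewrite mulr0.
have s0 k : fsin (fun _ : 'rV[R]_d => 0 : R) k = 0.
  by rewrite /fsin /Rintegral integral0_eq// => x _; rewrite mulr0.
apply: (@l1norm_le_of_fourier_cvg R d (fun _ _ => 0) _ 0) => //.
- by move=> _; exact: integrable0.
- by move=> _; rewrite /l1norm integral0_eq// => x _; rewrite normr0.
- by move=> k; rewrite f0 fcosB// !fcosE// gh subrr; exact: cvg_cst.
- by move=> k; rewrite s0 fsinB// !fsinE// gh subrr; exact: cvg_cst.
Qed.

End fourier_orbit.

(** * The semigroup of a process *)
Section levy_semigroup.
Context {R : realType} {d : nat} {disp : measure_display} {Omega : measurableType disp}.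
Variables (P : probability Omega R) (X : R -> Omega -> 'rV[R]_d).
Hypothesis hX : levy_process P X.
Variable psi : 'rV[R]_d -> R[i].
Hypothesis hchar : forall (t : R) (k : 'rV[R]_d), 0 <= t ->
  cintegral P setT (fun w => cexp ((dot k (X t w))*i)) = cexp (t%:C * psi k).
Local Notation mu := (lebesgue_rV R d).
Local Notation S := (levy_semigroup P X).

Let mX (t : R) : 0 <= t -> measurable_fun setT (X t).
Proof. by move=> t0; exact: (levy_measurable hX t0). Qed.

Let i1 : P.-integrable setT (EFin \o (fun _ : Omega => 1 : R)).
Proof. exact: finite_measure_integrable_cst. Qed.

Lemma levy_semigroupE t f : S t f = shift_mean P (fun=> 1) (X t) f.
Proof.
apply/funext => x; rewrite /levy_semigroup /shift_mean unlock; congr fine.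
by apply: eq_integral => w _; rewrite mul1r.
Qed.

Lemma integrable_levy t f : 0 <= t -> mu.-integrable setT (EFin \o f) ->
  mu.-integrable setT (EFin \o S t f).
Proof. by move=> t0 iff; rewrite levy_semigroupE; apply: integrable_shift_mean => //; exact: mX. Qed.

Let integralP1 : (\int[P]_w `|1 : R|%:E = 1)%E.
Proof. by rewrite normr1 integral_cst// mul1e; exact: probability_setT. Qed.

Lemma l1norm_levy_le t f : 0 <= t -> mu.-integrable setT (EFin \o f) ->
  (l1norm (S t f) <= l1norm f)%E.
Proof.
move=> t0 iff; rewrite levy_semigroupE -[leRHS]mul1e -integralP1.
by apply: l1norm_shift_mean_le => //; exact: mX.
Qed.

Lemma fourier_levy t f k : 0 <= t -> mu.-integrable setT (EFin \o f) ->
  fourier (S t f) k = cexp (t%:C * psi k) * fourier f k.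
Proof.
move=> t0 iff; rewrite (fourierE _ (integrable_levy t0 iff)) (fourierE _ iff) -hchar//.
rewrite levy_semigroupE fcos_shift_mean//; last exact: mX.
rewrite fsin_shift_mean//; last exact: mX.
have -> : cintegral P setT (fun w => cexp ((dot k (X t w))*i)) =
    (\int[P]_w (cos (dot k (X t w)) * 1)) +i* (\int[P]_w (sin (dot k (X t w)) * 1)).
  by congr (_ +i* _); apply: eq_Rintegral => w _; rewrite cexpi mulr1.
by simpc; congr (_ +i* _); ring.
Qed.

Lemma levy_generator_semigroup t f h : 0 <= t -> levy_generator psi f h ->
  levy_generator psi (S t f) (S t h).
Proof.
move=> t0 [/Lfun1_integrable iff /Lfun1_integrable ih fh]; split.
- by apply/Lfun1_integrable; exact: integrable_levy.
- by apply/Lfun1_integrable; exact: integrable_levy.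
- by move=> k; rewrite !fourier_levy// mulrCA fh.
Qed.

Lemma measurable_enorm : measurable_fun setT (@enorm R d).
Proof.
apply: (measurableT_comp (continuous_measurable_fun (@sqrt_continuous R))).
by apply: measurable_dotrV; exact: measurable_id.
Qed.

(** The distance from P(s)f to P(t)f is at most the expected modulus of f at
X_s - X_t.  The modulus is small where this increment is small, and elsewhere,
an event of small probability by stochastic continuity, it is at most twice the
norm of f. *)
Lemma levy_semigroup_continuous (t : R) f (e : R) : 0 <= t -> mu.-integrable setT (EFin \o f) ->
  0 < e -> \forall s \near within [set s : R | 0 <= s] (nbhs t),
    (l1norm (fun x => S s f x - S t f x)%R <= e%:E)%E.
Proof.
move=> t0 iff e0.
have e20 : 0 < e / 2 by rewrite divr_gt0.
have [a a0 small] := l1modulus_small iff e20.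
have [N N0 fN] : exists2 N : R, 0 < N & (2%:E * l1norm f <= N%:E)%E.
  exists (2 * fine (l1norm f) + 1); first by rewrite ltr_wpDl// mulr_ge0// fine_ge0// l1norm_ge0.
  by rewrite -(fineK (l1norm_fin iff)) -EFinM lee_fin lerDl.
have eN : 0 < e / 2 / N by rewrite divr_gt0.
have := levy_stochastically_continuous hX t0 a0.
move=> /ge0_cvge0P => /(_ (fun s => measure_ge0 _ _) _ eN).
rewrite !near_withinE; apply: filterS => s Ps s0; have {}Ps := Ps s0.
rewrite !levy_semigroupE.
apply: le_trans (l1norm_shift_meanB_le i1 (mX s0) (mX t0) iff) _.
pose B := [set w | a < enorm (X s w - X t w)].
have mD : measurable_fun setT (fun w => X s w - X t w).
  under eq_fun do rewrite -scaleN1r.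
  apply: measurable_addrV; first exact: mX.
  by apply: measurable_scalerV; [exact: measurable_cst|exact: mX].
have mB : measurable B.
  rewrite (_ : B = (fun w => enorm (X s w - X t w)) @^-1` `]a, +oo[); last first.
    by apply/seteqP; split => w /=; rewrite in_itv/= andbT.
  rewrite -[X in measurable X]setTI; apply: (measurableT_comp measurable_enorm mD) => //.
have mf := l1norm_measurable iff.
have mI : measurable_fun setT (fun w => l1modulus f (X s w - X t w)).
  apply: (measurable_fun_fubini_tonelli_G (m1 := mu)
    (fun p : 'rV[R]_d * Omega => `|f (p.1 + (X s p.2 - X t p.2)) - f p.1|%:E)) => //.
  apply: measurable_normB.
    apply: (measurableT_comp mf); apply: measurable_addrV; first exact: measurable_fst.
    exact: (measurableT_comp mD measurable_snd).
  exact: (measurableT_comp mf measurable_fst).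
apply: (@le_trans _ _ (\int[P]_w ((e / 2)%:E + N%:E * (\1_B w)%:E))%E).
  apply: ge0_le_integral => //.
  - by move=> w _; rewrite mule_ge0// l1modulus_ge0.
  - by apply: emeasurable_funM.
  - apply: emeasurable_funD => //; apply: emeasurable_funM => //.
    by apply/measurable_EFinP.
  - move=> w _; rewrite normr1 mul1e indicE.
    have [wB|wB] := boolP (w \in B).
      rewrite mule1; apply: le_trans (l1modulus_le _ mf) _.
      by apply: le_trans fN _; rewrite leeDr// lee_fin ltW.
    rewrite mule0 adde0; apply: small; rewrite leNgt; apply: contra wB => wB.
    by rewrite inE.
have e20' : 0 <= e / 2 by exact: ltW.
have N0' : 0 <= N by exact: ltW.
have mNB : measurable_fun setT (fun w => N%:E * (\1_B w)%:E)%E.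
  by apply: emeasurable_funM => //; exact/measurable_EFinP.
rewrite ge0_integralD//; last by move=> w _; rewrite mule_ge0// lee_fin.
have -> : (\int[P]__ (e / 2)%:E = (e / 2)%:E)%E.
  rewrite integral_cst//; transitivity ((e / 2)%:E * 1)%E; last by rewrite mule1.
  by congr (_ * _)%E; exact: probability_setT.
rewrite ge0_integralZl//; last exact/measurable_EFinP.
rewrite integral_indic// setIT [X in (_ <= X%:E)%E](splitr e) EFinD leeD2l//.
have -> : e / 2 = N * (e / 2 / N) by rewrite [RHS]mulrC divfK// gt_eqF.
by rewrite EFinM; apply: lee_wpmul2l; rewrite ?lee_fin.
Qed.

(** At a fixed frequency the semigroup follows an exponential orbit. *)
Let orbit_fourier (kappa : R[i]) q h k : 0 <= q -> mu.-integrable setT (EFin \o h) ->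
  complex.Re (kappa * fourier (S q h) k) = orbit_re (psi k) (kappa * fourier h k) q.
Proof. by move=> q0 ih; rewrite fourier_levy// /orbit_re mulrCA. Qed.

(** A Riemann sum of P(q)h - P(r)h over the subdivision points of [r, r'] has
norm at most |r' - r| m.  As the subdivision is refined its transform converges
to that of the function on the left, by [orbit_re_riemann] and because the
transform of h is psi times that of f; so the bound holds in the limit. *)
Lemma levy_increment_le (r r' m : R) f h : 0 <= r -> 0 <= r' -> 0 <= m ->
  levy_generator psi f h ->
  (forall q, 0 <= q -> (r <= q <= r') || (r' <= q <= r) ->
    (l1norm (fun x => S q h x - S r h x)%R <= m%:E)%E) ->
  (l1norm (fun x => S r' f x - S r f x - (r' - r) * S r h x)%R <= (`|r' - r| * m)%:E)%E.
Proof.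
move=> r0 r'0 m0 [/Lfun1_integrable iff /Lfun1_integrable ih fh] Hm.
pose dl n : R := (r' - r) / n.+1%:R.
pose q n (i : nat) : R := r + dl n * i%:R.
have qP n (i : 'I_n.+1) : (r <= q n i <= r') || (r' <= q n i <= r).
  have : 0 <= (i%:R / n.+1%:R : R) <= 1.
    by rewrite divr_ge0//= ler_pdivrMr ?ltr0n// mul1r ler_nat ltnW.
  have -> : q n i = r + (r' - r) * (i%:R / n.+1%:R) by rewrite /q /dl; ring.
  move: (i%:R / n.+1%:R) => th /andP[th0 th1].
  have [rr|rr] := leP r r'; apply/orP; [left|right]; apply/andP; split; nra.
have q0 n (i : 'I_n.+1) : 0 <= q n i.
  by have /orP[/andP[h1 _]|/andP[h1 _]] := qP n i; exact: le_trans h1.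
pose F n (i : 'I_n.+1) x := dl n * (S (q n i) h x - S r h x).
have iD n (i : 'I_n.+1) : mu.-integrable setT (EFin \o (fun x => S (q n i) h x - S r h x)).
  exact: (integrableB measurableT (integrable_levy (q0 n i) ih) (integrable_levy r0 ih)).
have iF n (i : 'I_n.+1) : mu.-integrable setT (EFin \o F n i).
  exact: (integrableZl measurableT _ (iD n i)).
have iT1 := integrableB measurableT (integrable_levy r'0 iff) (integrable_levy r0 iff).
have iT2 := integrableZl measurableT (r' - r) (integrable_levy r0 ih).
have iT : mu.-integrable setT (EFin \o (fun x => S r' f x - S r f x - (r' - r) * S r h x)).
  exact: (integrableB measurableT iT1 iT2).
(* kappa = 1 gives the cosine transform and kappa = i the sine transform *)
have key (fc : ('rV[R]_d -> R) -> 'rV[R]_d -> R) (kappa : R[i]) k :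
    (forall g, mu.-integrable setT (EFin \o g) -> fc g k = complex.Re (kappa * fourier g k)) ->
    (forall g1 g2, mu.-integrable setT (EFin \o g1) -> mu.-integrable setT (EFin \o g2) ->
      fc (fun x => g1 x - g2 x) k = fc g1 k - fc g2 k) ->
    (forall g (c : R), mu.-integrable setT (EFin \o g) -> fc (fun x => c * g x) k = c * fc g k) ->
    (forall n, fc (fun x => \sum_(i < n.+1) F n i x) k = \sum_(i < n.+1) fc (F n i) k) ->
    fc (fun x => \sum_(i < n.+1) F n i x) k @[n --> \oo] -->
      fc (fun x => S r' f x - S r f x - (r' - r) * S r h x) k.
  move=> fcE fcB fcZ fcS.
  have fcorb p g : 0 <= p -> mu.-integrable setT (EFin \o g) ->
      fc (S p g) k = orbit_re (psi k) (kappa * fourier g k) p.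
    by move=> p0 ig; rewrite fcE ?orbit_fourier//; exact: integrable_levy.
  have cE : kappa * fourier h k = psi k * (kappa * fourier f k) by rewrite mulrCA fh.
  rewrite fcB// fcB//; [|exact: integrable_levy|exact: integrable_levy].
  rewrite fcZ; last exact: integrable_levy.
  rewrite !fcorb// cE.
  have -> : (fun n => fc (fun x => \sum_(i < n.+1) F n i x) k) =
      fun n => \sum_(i < n.+1) (dl n * orbit_re (psi k) (psi k * (kappa * fourier f k)) (q n i)) -
        (r' - r) * orbit_re (psi k) (psi k * (kappa * fourier f k)) r.
    apply/funext => n; rewrite fcS.
    have -> : r' - r = \sum_(i < n.+1) dl n.
      by rewrite sumr_const card_ord -mulr_natr /dl divfK// pnatr_eq0.
    rewrite mulr_suml -sumrB; apply: eq_bigr => i _.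
    rewrite /F fcZ// fcB//; [|exact: integrable_levy|exact: integrable_levy].
    by rewrite !fcorb// cE mulrBr.
  by apply: cvgB; [exact: orbit_re_riemann|exact: cvg_cst].
apply: (@l1norm_le_of_fourier_cvg R d (fun n x => \sum_(i < n.+1) F n i x)) => //.
- by move=> n; apply: integrable_sum_l1.
- move=> n; have -> : `|r' - r| * m = (`|dl n| * m) *+ n.+1.
    have n1 : 0 <= (n.+1%:R^-1 : R) by rewrite invr_ge0.
    rewrite -mulrnAl -mulr_natr /dl normrM (ger0_norm n1).
    by rewrite divfK// pnatr_eq0.
  apply: l1norm_sum_le => // i; rewrite /F l1normZ; last exact: l1norm_measurable.
  by rewrite EFinM lee_wpmul2l ?lee_fin// Hm.
- move=> k; apply: (key _ 1).
  + by move=> g ig; rewrite mul1r fcosE.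
  + by move=> g1 g2 ? ?; exact: fcosB.
  + by move=> g c ?; exact: fcosZ.
  + by move=> n; exact: fcos_sum.
- move=> k; apply: (key _ (0 +i* 1)).
  + by move=> g ig; rewrite fsinE.
  + by move=> g1 g2 ? ?; exact: fsinB.
  + by move=> g c ?; exact: fsinZ.
  + by move=> n; exact: fsin_sum.
Qed.

Lemma levy_semigroup0 f : mu.-integrable setT (EFin \o f) -> S 0 f = f.
Proof.
move=> iff; have mf := l1norm_measurable iff.
apply/funext => x; rewrite /levy_semigroup unlock.
rewrite (@ae_eq_integral _ _ _ P setT (cst (f x)%:E)) //.
- rewrite integral_cst//; transitivity (fine ((f x)%:E * 1)); last by rewrite mule1.
  by congr (fine (_ * _)); exact: probability_setT.
- apply/measurable_EFinP; apply: (measurableT_comp mf); apply: measurable_addrV.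
    exact: measurable_cst.
  exact: mX.
- by apply: filterS (levy_start0 hX) => w -> _; rewrite addr0.
Qed.

End levy_semigroup.

(** * The Cauchy problem *)
Section time_change.
Context {R : realType}.
Variable alpha : R.
Hypothesis alpha0 : 0 < alpha.

Definition conformable_time (t : R) : R := t `^ alpha / alpha.

Lemma conformable_time_ge0 t : 0 <= conformable_time t.
Proof. by rewrite divr_ge0 ?powR_ge0// ltW. Qed.

Lemma conformable_time0 : conformable_time 0 = 0.
Proof. by rewrite /conformable_time powR0 ?mul0r// gt_eqF. Qed.

Lemma is_derive_conformable_time (t : R) : 0 < t ->
  is_derive t (1 : R) conformable_time (t `^ (alpha - 1)).
Proof.
move=> t0; have dp := is_derive1_powR alpha t0.
apply: is_derive_eq.
have sc (x y : R) : x *: (y : R^o) = x * y by [].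
by rewrite !sc mulr0 add0r mulrA mulVf ?mul1r// gt_eqF.
Qed.

Lemma continuous_conformable_time (t : R) : 0 <= t ->
  conformable_time x @[x --> within [set s : R | 0 <= s] (nbhs t)] --> conformable_time t.
Proof.
rewrite le_eqVlt => /predU1P[<-|t0].
  rewrite conformable_time0; apply/cvgrPdist_le => e e0.
  have ea : 0 < e * alpha by rewrite mulr_gt0.
  have pw0 : 0 < (e * alpha) `^ alpha^-1 by rewrite powR_gt0.
  rewrite near_withinE; apply: filterS (@nbhs0_le R R _ pw0) => x xe /= x0.
  rewrite sub0r normrN ger0_norm ?conformable_time_ge0// /conformable_time ler_pdivrMr//.
  have -> : e * alpha = ((e * alpha) `^ alpha^-1) `^ alpha.
    by rewrite -powRrM mulVf ?powRr1 ?ltW// gt_eqF.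
  apply: ge0_ler_powR; [exact: ltW|by rewrite nnegrE|by rewrite nnegrE powR_ge0|].
  exact: le_trans (ler_norm _) xe.
apply: cvg_within_filter; apply: differentiable_continuous.
by apply/derivable1_diffP; case: (is_derive_conformable_time t0).
Qed.

(** The conformable derivative differentiates along t + e t^(1 - alpha), a curve
that the time change runs through with unit speed. *)
Lemma conformable_time_speed (t : R) : 0 < t ->
  (conformable_time (t + e * t `^ (1 - alpha)) - conformable_time t) / e
    @[e --> 0^'] --> (1 : R).
Proof.
move=> t0; pose c := t `^ (1 - alpha).
have tE : t = t + 0 * c by rewrite mul0r addr0.
have ds := is_derive_conformable_time t0; rewrite {1}tE in ds.
have [dp vp] : is_derive (0 : R) (1 : R) (fun e : R => conformable_time (t + e * c)) 1.
  have dl : is_derive (0 : R) (1 : R) (fun e : R => t + e * c) c.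
    apply: is_derive_eq.
    have sc (x y : R) : x *: (y : R^o) = x * y by [].
    by rewrite !sc; ring.
  have := @is_derive1_comp R conformable_time (fun e : R => t + e * c) 0 _ _ ds dl; rewrite /c -powRD; last by rewrite (gt_eqF t0) implybT.
  by rewrite addrA subrK subrr powRr0.
rewrite (_ : (fun e => _) = fun h : R => h^-1 *:
    (((fun e : R => conformable_time (t + e * c)) \o shift 0) (h *: (1 : R)) -
     conformable_time (t + 0 * c))); first by rewrite -[X in _ --> X]vp; exact: dp.
apply/funext => e /=.
by rewrite addr0 mul0r addr0 [e *: _]mulr1 [LHS]mulrC.
Qed.

End time_change.

Section cvg_L1.
Context {R : realType} {d : nat}.
Local Notation mu := (lebesgue_rV R d).

Lemma cvg_L1P (F : set_system R) {FF : Filter F} (g : R -> 'rV[R]_d -> R) l :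
  cvg_L1 F g l <-> (forall e : R, 0 < e ->
    \forall s \near F, (l1norm (fun x => g s x - l x)%R <= e%:E)%E).
Proof.
have N1 s : Lnorm mu 1%E (fun x => (g s x - l x)%:E) = l1norm (fun x => g s x - l x).
  by rewrite Lnorm1.
rewrite /cvg_L1; under eq_fun do rewrite N1.
by apply: ge0_cvge0P => s; exact: l1norm_ge0.
Qed.

Lemma cvg_L1_fcos (F : set_system R) {FF : Filter F} (g : R -> 'rV[R]_d -> R) l k :
  (\forall s \near F, mu.-integrable setT (EFin \o g s)) ->
  mu.-integrable setT (EFin \o l) -> cvg_L1 F g l ->
  fcos (g s) k @[s --> F] --> fcos l k.
Proof.
move=> ig il /cvg_L1P gl; apply/cvgrPdist_le => e e0.
apply: filterS2 ig (gl e e0) => s igs /= gle.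
rewrite distrC -fcosB// -lee_fin; apply: le_trans gle.
by apply: fcos_norm_le; exact: (integrableB measurableT igs il).
Qed.

Lemma cvg_L1_fsin (F : set_system R) {FF : Filter F} (g : R -> 'rV[R]_d -> R) l k :
  (\forall s \near F, mu.-integrable setT (EFin \o g s)) ->
  mu.-integrable setT (EFin \o l) -> cvg_L1 F g l ->
  fsin (g s) k @[s --> F] --> fsin l k.
Proof.
move=> ig il /cvg_L1P gl; apply/cvgrPdist_le => e e0.
apply: filterS2 ig (gl e e0) => s igs /= gle.
rewrite distrC -fsinB// -lee_fin; apply: le_trans gle.
by apply: fsin_norm_le; exact: (integrableB measurableT igs il).
Qed.

End cvg_L1.

Section conformable_derivative.
Context {R : realType}.

(** Rescale the increment by c = t^(1 - alpha). *)
Lemma is_derive_of_conformable (alpha t L : R) (A : R -> R) : 0 < t ->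
  (A (t + e * t `^ (1 - alpha)) - A t) / e @[e --> 0^'] --> L ->
  is_derive t (1 : R) A (t `^ (alpha - 1) * L).
Proof.
move=> t0; set c := t `^ (1 - alpha) => cA.
have c0 : 0 < c by exact: powR_gt0.
have cV : t `^ (alpha - 1) = c^-1 by rewrite /c -powRN opprB.
have ch : h / c @[h --> 0^'] --> (0 : R)^'.
  move=> B; rewrite /dnbhs /within/= => /(@nbhs_ballP R R)[e /= e0 eB].
  apply/(@nbhs_ballP R R); exists (e * c); first by rewrite /= mulr_gt0.
  move=> h; rewrite /ball/= sub0r normrN => he h0; apply: eB => /=.
    by rewrite /ball/= sub0r normrN normrM (gtr0_norm (_ : 0 < c^-1)) ?invr_gt0// ltr_pdivrMr.
  by rewrite mulf_neq0// invr_neq0// gt_eqF.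
have lim : h^-1 *: ((A \o shift t) (h *: (1 : R)) - A t) @[h --> 0^'] --> t `^ (alpha - 1) * L.
  rewrite cV.
  have lim' : c^-1 * ((A (t + h / c * c) - A t) / (h / c)) @[h --> 0^'] --> c^-1 * L.
    by apply: cvgM; [exact: cvg_cst|exact: (cvg_comp _ _ ch cA)].
  apply: cvg_trans lim'; apply: near_eq_cvg; near=> h.
  have h0 : h != 0 by near: h; exact: nbhs_dnbhs_neq.
  have sc (x y : R) : x *: (y : R^o) = x * y by [].
  rewrite /= sc [h *: _]mulr1 divfK ?gt_eqF// (addrC t) invf_div.
  by field; rewrite h0 gt_eqF.
apply: DeriveDef; first by apply/cvg_ex; exists (t `^ (alpha - 1) * L).
exact: cvg_lim lim.
Unshelve. all: by end_near. Qed.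

End conformable_derivative.

Section levy_solution.
Context {R : realType} {d : nat} {disp : measure_display} {Omega : measurableType disp}.
Variables (P : probability Omega R) (X : R -> Omega -> 'rV[R]_d).
Hypothesis hX : levy_process P X.
Variable psi : 'rV[R]_d -> R[i].
Hypothesis hchar : forall (t : R) (k : 'rV[R]_d), 0 <= t ->
  cintegral P setT (fun w => cexp ((dot k (X t w))*i)) = cexp (t%:C * psi k).
Variable alpha : R.
Hypothesis alpha0 : 0 < alpha.
Local Notation mu := (lebesgue_rV R d).
Local Notation S := (levy_semigroup P X).
Local Notation s := (conformable_time alpha).

Let s0 t : 0 <= s t.
Proof. exact: conformable_time_ge0. Qed.

(** With w the increment of the time change over the step eps, the error of the
difference quotient is the error of [levy_increment_le] divided by eps, plus
w / eps - 1 times P(s)h; the ratio w / eps tends to 1. *)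
Lemma levy_conformable_derivative (t : R) f h : 0 < t -> levy_generator psi f h ->
  conformable_derivative_L1 alpha (fun t => S (s t) f) t (S (s t) h).
Proof.
move=> t0 fh; have [/Lfun1_integrable iff /Lfun1_integrable ih _] := fh.
apply/cvg_L1P => e e0.
pose H := fine (l1norm h) + 1.
have H0 : 0 < H by rewrite ltr_wpDl// fine_ge0// l1norm_ge0.
have ish := integrable_levy hX (s0 t) ih.
have hH : (l1norm (S (s t) h) <= H%:E)%E.
  apply: le_trans (l1norm_levy_le hX (s0 t) ih) _.
  by rewrite -(fineK (l1norm_fin ih)) lee_fin lerDl.
have e40 : 0 < e / 4 by rewrite divr_gt0.
have := levy_semigroup_continuous hX (s0 t) ih e40.
rewrite near_withinE => /(@nbhs_ballP R R)[r /= r0 rP].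
have eH0 : 0 < e / 2 / H by rewrite !divr_gt0.
have /cvgrPdist_le speed := conformable_time_speed alpha0 t0.
near=> eps.
have eps0 : eps != 0 by near: eps; exact: nbhs_dnbhs_neq.
pose t' := t + eps * t `^ (1 - alpha).
pose w := s t' - s t.
have w1 : `|w / eps - 1| <= 1 by rewrite distrC /w /t'; near: eps; apply: speed.
have wH : `|w / eps - 1| <= e / 2 / H by rewrite distrC /w /t'; near: eps; apply: speed.
have epsr : `|eps| < r / 2.
  by near: eps; apply: nbhs_dnbhs; apply: (@nbhs0_lt R R); rewrite divr_gt0.
have w2 : `|w| <= 2 * `|eps|.
  have -> : w = w / eps * eps by rewrite divfK.
  rewrite normrM ler_wpM2r//.
  have -> : w / eps = (w / eps - 1) + 1 by rewrite subrK.
  rewrite (le_trans (ler_normD _ _))// normr1 (_ : 2 = 1 + 1); last by ring.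
  by rewrite lerD2r.
have wr : `|w| < r.
  by rewrite (le_lt_trans w2)// mulrC -ltr_pdivlMr.
have inc := levy_increment_le hX hchar (s0 t) (s0 t') (ltW e40) fh.
have {inc} inc : (l1norm (fun x => S (s t') f x - S (s t) f x - w * S (s t) h x)%R <=
    (`|w| * (e / 4))%:E)%E.
  apply: inc => q q0 qb; apply: rP => //=; apply: le_lt_trans wr.
  rewrite /w; case/orP : qb => /andP[h1 h2].
    by rewrite distrC !ger0_norm ?subr_ge0 ?(le_trans h1)// lerD2r.
  by rewrite ger0_norm ?subr_ge0// ler0_norm ?subr_le0 ?(le_trans h1)// opprB lerD2l lerN2.
have mS1 := l1norm_measurable (integrable_levy hX (s0 t') iff).
have mS2 := l1norm_measurable (integrable_levy hX (s0 t) iff).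
have mS3 := l1norm_measurable ish.
have mI : measurable_fun setT (fun x => S (s t') f x - S (s t) f x - w * S (s t) h x).
  by apply: measurable_funB; [exact: measurable_funB|exact: measurable_funM].
apply: (@le_trans _ _ (l1norm (fun x => eps^-1 * (S (s t') f x - S (s t) f x - w * S (s t) h x))%R +
    l1norm (fun x => (w / eps - 1) * S (s t) h x)%R)%E).
  apply: l1norm_add_le.
  - apply: measurable_funB => //; apply: measurable_funM => //.
    exact: measurable_funB.
  - exact: measurable_funM.
  - exact: measurable_funM.
  - move=> x; rewrite -/t'; apply: le_trans (ler_normD _ _).
    rewrite le_eqVlt; apply/orP; left; apply/eqP; congr (`| _ |).
    by field.
rewrite !l1normZ//.
have {}inc : (`|eps^-1|%:E * l1norm (fun x => S (s t') f x - S (s t) f x - w * S (s t) h x)%R <=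
    (e / 2)%:E)%E.
  apply: (@le_trans _ _ (`|eps^-1|%:E * (`|w| * (e / 4))%:E)%E); first exact: lee_wpmul2l.
  rewrite -EFinM lee_fin mulrA (_ : e / 2 = 2 * (e / 4)); last by field.
  rewrite ler_wpM2r ?(ltW e40)// normfV ler_pdivrMl ?normr_gt0//.
  by rewrite mulrC.
rewrite (splitr e) EFinD; apply: leeD => //.
apply: (@le_trans _ _ ((e / 2 / H)%:E * H%:E)%E).
  apply: (@le_trans _ _ (`|w / eps - 1|%:E * H%:E)%E); first exact: lee_wpmul2l.
  by rewrite -!EFinM lee_fin ler_wpM2r// ltW.
by rewrite -EFinM divfK// gt_eqF.
Unshelve. all: by end_near. Qed.

(** The L1 convergences in the definition of a solution imply convergence of the
transforms at k, which therefore solve the linear equation of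
[orbit_unique]. *)
Lemma cauchy_solution_fourier f v (t : R) k : cauchy_solution alpha psi f v -> 0 <= t ->
  mu.-integrable setT (EFin \o f) ->
  fourier (v t) k = cexp ((s t)%:C * psi k) * fourier f k.
Proof.
move=> [vL1 vcont vinit veq] t0 iff.
have iv x : 0 <= x -> mu.-integrable setT (EFin \o v x).
  by move=> x0; apply/Lfun1_integrable; exact: vL1.
pose A x := fcos (v x) k; pose B x := - fsin (v x) k.
have vE x : 0 <= x -> fourier (v x) k = A x +i* B x by move=> x0; rewrite fourierE//; exact: iv.
have fE : fourier f k = A 0 +i* B 0.
  have mv := l1norm_measurable (iv 0 (lexx 0)).
  have mf := l1norm_measurable iff.
  rewrite fourierE// /A /B; congr (_ +i* - _).
    exact/esym/(fcos_ae k mv mf vinit).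
  exact/esym/(fsin_ae k mv mf vinit).
have right0 : (0 : R)^'+ --> within [set y : R | 0 <= y] (nbhs (0 : R)).
  move=> U; rewrite /at_right /within/= => /(@nbhs_ballP R R)[r /= r0 rU].
  apply/(@nbhs_ballP R R); exists r => // y ry y0.
  by apply: rU => //; exact: ltW.
have near0 : \forall y \near within [set y : R | 0 <= y] (nbhs (0 : R)),
    mu.-integrable setT (EFin \o v y).
  by rewrite near_withinE; apply: nearW => y; exact: iv.
have cA : A x @[x --> 0^'+] --> A 0.
  apply: cvg_trans (cvg_app A right0) _.
  exact: cvg_L1_fcos near0 (iv 0 (lexx 0)) (vcont 0 (lexx 0)).
have cB : B x @[x --> 0^'+] --> B 0.
  apply: cvgN; apply: cvg_trans (cvg_app (fun x => fsin (v x) k) right0) _.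
  exact: cvg_L1_fsin near0 (iv 0 (lexx 0)) (vcont 0 (lexx 0)).
have cs : s x @[x --> 0^'+] --> s 0.
  apply: cvg_trans (cvg_app s right0) _.
  exact: continuous_conformable_time.
case psiE : (psi k) => [a b].
rewrite vE// fE.
have step (x : R) : 0 < x -> is_derive x (1 : R) A (x `^ (alpha - 1) * (a * A x - b * B x)) /\
    is_derive x (1 : R) B (x `^ (alpha - 1) * (a * B x + b * A x)).
  move=> x0; have [h [_ /Lfun1_integrable ih gh] ch] := veq x x0.
  have ix := iv x (ltW x0).
  have := gh k; rewrite psiE vE ?ltW// fourierE//; simpc => -[Eh1 Eh2].
  pose g (e : R) y := (v (x + e * x `^ (1 - alpha)) y - v x y) / e.
  have c0 : 0 < x `^ (1 - alpha) by exact: powR_gt0.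
  (* a solution is integrable at nonnegative times only *)
  have near_pos : \forall e \near (0 : R)^', 0 <= x + e * x `^ (1 - alpha).
    apply: nbhs_dnbhs.
    have xc : 0 < x / x `^ (1 - alpha) by rewrite divr_gt0.
    apply: filterS (@nbhs0_le R R _ xc) => e.
    rewrite ler_norml => /andP[e1 _].
    have := e1; rewrite -mulNr ler_pdivrMr// => e1'.
    by rewrite -lerBlDl sub0r.
  have gE (e : R) : 0 <= x + e * x `^ (1 - alpha) ->
      [/\ mu.-integrable setT (EFin \o g e),
        fcos (g e) k = (A (x + e * x `^ (1 - alpha)) - A x) / e &
        - fsin (g e) k = (B (x + e * x `^ (1 - alpha)) - B x) / e].
    move=> xe; have ixe := iv _ xe.
    have iB := integrableB measurableT ixe ix.
    have gM : g e = fun y => e^-1 * (v (x + e * x `^ (1 - alpha)) y - v x y).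
      by apply/funext => y; rewrite /g mulrC.
    rewrite gM; split; first exact: (integrableZl measurableT _ iB).
      by rewrite fcosZ// fcosB// mulrC.
    by rewrite fsinZ// fsinB// /B; ring.
  have ig : \forall e \near (0 : R)^', mu.-integrable setT (EFin \o g e).
    by apply: filterS near_pos => e /gE[].
  split; apply: is_derive_of_conformable => //.
    rewrite Eh1.
    have cg : fcos (g e) k @[e --> (0 : R)^'] --> fcos h k by exact: cvg_L1_fcos ig ih ch.
    apply: cvg_trans cg.
    by apply: near_eq_cvg; apply: filterS near_pos => e /gE[_ -> _].
  rewrite Eh2.
  have cg : - fsin (g e) k @[e --> (0 : R)^'] --> - fsin h k.
    by apply: cvgN; exact: cvg_L1_fsin ig ih ch.
  apply: cvg_trans cg.
  by apply: near_eq_cvg; apply: filterS near_pos => e /gE[_ _ <-].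
apply: (@orbit_unique R a b s (fun x => x `^ (alpha - 1)) A B t) => //.
- exact: conformable_time0.
- by move=> x x0; exact: is_derive_conformable_time.
- by move=> x /step[].
- by move=> x /step[].
Qed.

End levy_solution.

Theorem theorem3p2 (R : realType) (d : nat) (alpha : R)
    (disp : measure_display) (Omega : measurableType disp)
    (P : probability Omega R) (X : R -> Omega -> 'rV[R]_d)
    (a : 'rV[R]_d) (Q : 'M[R]_d) (phi : {measure set 'rV[R]_d -> \bar R})
    (halpha : 0 < alpha < 1)
    (hX : levy_process P X)
    (htriplet : levy_triplet Q phi)
    (hchar : forall (t : R) (k : 'rV[R]_d), 0 <= t ->
       cintegral P setT (fun w => cexp ((dot k (X t w))*i)) =
       cexp (t%:C * levy_exponent a Q phi k))
    (f : 'rV[R]_d -> R) (hf : levy_domain (levy_exponent a Q phi) f) :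
  let u (t : R) := levy_semigroup P X (t `^ alpha / alpha) f in
  cauchy_solution alpha (levy_exponent a Q phi) f u /\
  (forall v : R -> 'rV[R]_d -> R, cauchy_solution alpha (levy_exponent a Q phi) f v ->
     forall t : R, 0 <= t -> v t = u t %[ae lebesgue_rV R d]).
Proof.
move=> u; have /andP[alpha0 alpha1] := halpha.
move: (levy_exponent a Q phi) hchar hf => psi {}hchar [h fh].
have [/Lfun1_integrable iff /Lfun1_integrable ih _] := fh.
pose s := conformable_time alpha.
have s0 t : 0 <= s t by exact: conformable_time_ge0.
have iu t : (lebesgue_rV R d).-integrable setT (EFin \o u t).
  exact: (integrable_levy hX (s0 t) iff).
split.
  split.
  - by move=> t t0; apply/Lfun1_integrable; exact: iu.
  - move=> t t0; apply/cvg_L1P => e e0.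
    have := levy_semigroup_continuous hX (s0 t) iff e0.
    rewrite !near_withinE => H.
    have := continuous_conformable_time alpha0 t0 H.
    rewrite /nbhs/= /within/=; apply: filterS => x xP x0.
    exact: (xP x0 (s0 x)).
  - apply: aeW => x; rewrite /u -/(conformable_time alpha 0) conformable_time0//.
    by rewrite (levy_semigroup0 hX).
  - move=> t t0; exists (levy_semigroup P X (s t) h).
      exact: (levy_generator_semigroup hX hchar (s0 t) fh).
    exact: (levy_conformable_derivative hX hchar alpha0 t0 fh).
move=> v hv t t0; apply: fourier_inj_ae => //.
  by apply/Lfun1_integrable; exact: cauchy_L1 hv t t0.
move=> k; rewrite (cauchy_solution_fourier alpha0 k hv t0 iff).
by rewrite (fourier_levy hX hchar k (s0 t) iff).
Qed.
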